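(* Suppose that $s$, $k$ and $r$ are natural numbers with $k\ge 4$, $$2\le r\le k-\lceil 2\sqrt{k}\rceil +2\quad\text{and}\quad \max\{2r-1,\tfrac{1}{2}r(r-1)+\Delta\}\le s<s_1,$$ where $$\Delta=\sum_{m=1}^{r-1}\frac{m(r-m)}{s-m}$$ and $$s_1=\tfrac{1}{2}\bigl(kr-\tfrac{1}{2}r(r-1)-\Delta\bigr)\left(1+\sqrt{1-\frac{4r(\tfrac{1}{2}r(r-1)+\Delta)}{(kr-\tfrac{1}{2}r(r-1)-\Delta)^2}}\right).$$ Then for each $\varepsilon>0$, one has $J_{s+r,k}(X)\ll X^{s+r+\varepsilon}$.
   Context: For natural numbers $k,t$ and a large real number $X$, $J_{t,k}(X)$ denotes the number of integral solutions of the system $x_1^j+\ldots+x_t^j=y_1^j+\ldots+y_t^j$ $(1\le j\le k)$ with $1\le x_i,y_i\le X$ $(1\le i\le t)$. The implicit constant in $\ll$ may depend on $s$, $k$, $r$ and $\varepsilon$, but not on $X$. *)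

(* Defs.v *)
From mathcomp Require Import all_boot all_order all_algebra.
From mathcomp Require Import all_classical all_reals all_analysis.

Set Implicit Arguments.
Unset Strict Implicit.
Unset Printing Implicit Defensive.

Import Order.TTheory GRing.Theory Num.Theory.

Local Open Scope ring_scope.

(* [Vinogradov_count t k X] is J_{t,k}(X). The integers in [1, X] are the
   naturals 1, ..., floor X, so the unknowns are taken in the finite type of
   naturals at most floor X and then required to be positive. *)
Definition Vinogradov_count (R : realType) (t k : nat) (X : R) : nat :=
  let Z := {ffun 'I_t -> 'I_(Num.truncn X).+1} in
  #|[set xy : Z * Z |
      [&& [forall i, (1 <= xy.1 i)%N && (1 <= xy.2 i)%N] &
          [forall j : 'I_k.+1, (1 <= j)%N ==>
             (\sum_(i < t) xy.1 i ^ j == \sum_(i < t) xy.2 i ^ j)%N]]]|.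

Definition Delta (R : realType) (s r : nat) : R :=
  \sum_(1 <= m < r) (m%:R * (r%:R - m%:R)) / (s%:R - m%:R).

(* Delta, hence also s1, depends on s. *)
Definition s1 (R : realType) (s k r : nat) : R :=
  let D : R := Delta R s r in
  let A : R := 2^-1 * r%:R * (r%:R - 1) + D in
  let B : R := k%:R * r%:R - 2^-1 * r%:R * (r%:R - 1) - D in
  2^-1 * B * (1 + Num.sqrt (1 - (4 * r%:R * A) / B ^+ 2)).

(* Main.v *)
(* The condition on r gives s + r <= k (k + 1) / 2, so the bound is a case of the full
   mean value theorem. That theorem follows from a p-adic form of the l^2 decoupling
   argument of Guo, Li, Yung and Zorin-Kranich, for one fixed prime p > k. Bilinear
   integrals over two residue classes that are distinct mod p are improved alternately
   by Hoelder's inequality and by decoupling in lower degree, which is applied to the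
   exponential sum over one class with a power of the sum over the other as weight.
   Every round gains a fixed amount on average over the degrees, so any positive
   exponent of the decoupling constant can be lowered. *)

Require Import Defs.
From mathcomp Require Import all_boot all_order all_algebra.
From mathcomp Require Import all_classical all_reals all_analysis.
From mathcomp Require Import cyclic separable cyclotomic complex ring lra zify.

Set Implicit Arguments.
Unset Strict Implicit.
Unset Printing Implicit Defensive.

Import Order.TTheory GRing.Theory Num.Theory.

Local Open Scope ring_scope.

(** * Elementary inequalities, squared moduli and residues modulo powers of p *)

Section ElementaryInequalities.
Variable R : realType.
Implicit Types x y z : R.

(** Why the degree drops: let x run over the class of xi mod p^a and u over the class of eta mod
    p^b, with xi - eta prime to p. Powers of u - eta of order above k - l are divisible by p^(b (k -
    l + 1)), so up to this modulus the l equations of degrees k - l + 1, ..., k concern the x alone.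
    Powers of x - xi of order above l are divisible by p^(a (l + 1)). What is left is a system of
    degree l in x, valid mod p^(l (a + e)) as long as l (a + e) is at most both exponents; then e
    further scales of x can be decoupled in degree l. Hence x carries the critical exponent [crit l]
    and u the rest, [crit k - crit l]. The process stops at the scale b (k - l + 1) / l for x. There
    the form of degree l lies between the form of degree k - l with the classes exchanged, whose
    reference scale is this larger one, and the form of degree l - 1. In degree 0 only the class mod
    p^b remains, and rescaling it saves b scales; all savings originate there. *)

Lemma exprM_le_exprD x y m n : 0 <= x -> 0 <= y ->
  x ^+ m * y ^+ n <= x ^+ (m + n) + y ^+ (m + n).
Proof.
move=> x0 y0; case: (leP x y) => xy.
  apply: (@le_trans _ _ (y ^+ (m + n))); last by rewrite lerDr exprn_ge0.
  by rewrite exprD ler_wpM2r ?exprn_ge0// lerXn2r.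
apply: (@le_trans _ _ (x ^+ (m + n))); last by rewrite lerDl exprn_ge0.
by rewrite exprD ler_wpM2l ?exprn_ge0// lerXn2r// ltW.
Qed.

(** The arithmetic-geometric mean inequality for x and m copies of y. Phrased with powers, it
    replaces Hölder's inequality with weights 1/(m+1) and m/(m+1) and avoids roots. *)
Lemma weighted_AGM m a x y : 0 <= a -> 0 <= x -> 0 <= y ->
  a ^+ m.+1 <= x * y ^+ m -> a *+ m.+1 <= x + y *+ m.
Proof.
move=> a0 x0 y0 h.
pose E (i : 'I_m.+1) : R := if i == ord0 then x else y.
have E0 : {in [pred i : 'I_m.+1 | true], forall i, 0 <= E i}.
  by move=> i _; rewrite /E; case: ifP.
have S : \sum_i E i = x + y *+ m.
  rewrite big_ord_recl /E /=; congr (_ + _).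
  by rewrite sumr_const card_ord.
have P : \prod_i E i = x * y ^+ m.
  rewrite big_ord_recl /E /=; congr (_ * _).
  by rewrite prodr_const card_ord.
have /= := (leif_AGM E0).1.
have -> : #|[pred i : 'I_m.+1 | true]| = m.+1 by rewrite -[RHS]card_ord; apply: eq_card.
rewrite S P => /(le_trans h) H.
rewrite -mulr_natr -ler_pdivlMr ?ltr0n//.
rewrite -(ler_pXn2r (n := m.+1)) // nnegrE// divr_ge0//.
by rewrite addr_ge0// mulrn_wge0.
Qed.

Lemma sum_expr_le (I : finType) (P : pred I) (F : I -> R) n :
  (forall i, P i -> 0 <= F i) ->
  \sum_(i | P i) F i ^+ n.+1 <= (\sum_(i | P i) F i) ^+ n.+1.
Proof.
move=> F0; have S0 : 0 <= \sum_(i | P i) F i by exact: sumr_ge0.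
rewrite exprS mulr_suml; apply: ler_sum => i Pi.
rewrite exprS ler_wpM2l ?F0// lerXn2r ?nnegrE ?F0//.
by rewrite (bigD1 i)//= lerDl sumr_ge0// => j /andP[/F0].
Qed.

Lemma expr_sum_le (I : finType) (P : pred I) (F : I -> R) n :
  (forall i, P i -> 0 <= F i) ->
  (\sum_(i | P i) F i) ^+ n.+1 <= #|P|%:R ^+ n.+1 * \sum_(i | P i) F i ^+ n.+1.
Proof.
move=> F0.
case: (pickP P) => [i0 Pi0|P0]; last first.
  by rewrite !big_pred0// !expr0n/= mulr0.
have [i Pi Hi] : exists2 i, P i & forall j, P j -> F j <= F i.
  by case: (Order.TotalTheory.arg_maxP F Pi0) => i Pi Hi; exists i.
apply: (@le_trans _ _ ((#|P|%:R * F i) ^+ n.+1)).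
  rewrite lerXn2r ?nnegrE ?sumr_ge0 ?mulr_ge0 ?F0//.
  rewrite mulr_natl -sumr_const; exact: ler_sum.
rewrite exprMn ler_wpM2l ?exprn_ge0//.
by rewrite (bigD1 i)//= lerDl sumr_ge0// => j /andP[/F0 ? _]; rewrite exprn_ge0.
Qed.
End ElementaryInequalities.

Section SquaredModulus.
Variable R : realType.
Implicit Types z : R[i].

Definition csq z : R := complex.Re z ^+ 2 + complex.Im z ^+ 2.

Lemma csq_ge0 z : 0 <= csq z.
Proof. by rewrite addr_ge0 ?sqr_ge0. Qed.

Lemma csqE z : (csq z)%:C%C = z * (z^*)%C.
Proof. by case: z => a b; apply/eqP; rewrite eq_complex /csq /=; apply/andP; split; apply/eqP; ring. Qed.

(** In each coordinate the difference of the two sides is the square (d u - v)^2 / d. The factor 1 +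
    d close to 1 is what the broad-narrow inequality needs. *)
Lemma csqD (d : R) z z' : 0 < d -> csq (z + z') <= (1 + d) * csq z + (1 + d^-1) * csq z'.
Proof.
case: z z' => [a b] [a' b'] d0; rewrite /csq /=.
have E u v : (u + v) ^+ 2 <= (1 + d) * u ^+ 2 + (1 + d^-1) * v ^+ 2.
  rewrite -subr_ge0.
  have -> : (1 + d) * u ^+ 2 + (1 + d^-1) * v ^+ 2 - (u + v) ^+ 2 =
     (d * u - v) ^+ 2 / d.
    by field; rewrite gt_eqF.
  by rewrite divr_ge0 ?sqr_ge0// ltW.
apply: (le_trans (lerD (E a a') (E b b'))).
by rewrite le_eqVlt; apply/orP; left; apply/eqP; ring.
Qed.

Lemma csq_sum_le (I : finType) (P : pred I) (F : I -> R[i]) :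
  csq (\sum_(i | P i) F i) <= #|P|%:R ^+ 2 * \sum_(i | P i) csq (F i).
Proof.
have S (G : I -> R) : (\sum_(i | P i) G i) ^+ 2 <= #|P|%:R ^+ 2 * \sum_(i | P i) G i ^+ 2.
  rewrite -real_normK ?num_real//.
  apply: (@le_trans _ _ ((\sum_(i | P i) `|G i|) ^+ 2)).
    by rewrite lerXn2r ?nnegrE ?sumr_ge0// ler_norm_sum.
  apply: le_trans (@expr_sum_le R I P (fun i => `|G i|) 1 _) _ => //.
  by rewrite ler_wpM2l ?exprn_ge0// ler_sum// => i _; rewrite real_normK ?num_real.
have ReS : complex.Re (\sum_(i | P i) F i) = \sum_(i | P i) complex.Re (F i).
  by apply: (big_morph (@complex.Re R)) => // -[? ?] [? ?].
have ImS : complex.Im (\sum_(i | P i) F i) = \sum_(i | P i) complex.Im (F i).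
  by apply: (big_morph (@complex.Im R)) => // -[? ?] [? ?].
by rewrite /csq ReS ImS big_split /= mulrDr lerD.
Qed.

End SquaredModulus.

Section ResidueClasses.
Variable p : nat.
Hypothesis p_gt0 : (0 < p)%N.

Lemma modn_expnD a d c : (c %% p ^ (a + d) = c %% p ^ a + p ^ a * ((c %/ p ^ a) %% p ^ d))%N.
Proof.
have h e : (0 < p ^ e)%N by rewrite expn_gt0 p_gt0.
rewrite {1}(divn_eq c (p ^ a)%N) {1}(divn_eq (c %/ p ^ a) (p ^ d)) mulnDl -mulnA -expnD (addnC d).
rewrite -addnA modnMDl.
rewrite modn_small 1?addnC 1?mulnC//.
have h1 := ltn_pmod (c %/ p ^ a) (h d); have h2 := ltn_pmod c (h a).
rewrite expnD; nia.
Qed.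

Lemma modn_expn_refine a d c xi v : (xi < p ^ a)%N -> (v < p ^ d)%N ->
  (c %% p ^ (a + d) == xi + p ^ a * v = (c %% p ^ a == xi) && ((c %/ p ^ a) %% p ^ d == v))%N.
Proof.
move=> hxi hv; rewrite modn_expnD.
have h e : (0 < p ^ e)%N by rewrite expn_gt0 p_gt0.
have h2 := ltn_pmod c (h a).
apply/eqP/andP => [H|[/eqP-> /eqP->]//].
have : ((c %% p ^ a + p ^ a * ((c %/ p ^ a) %% p ^ d)) %% p ^ a = (xi + p ^ a * v) %% p ^ a)%N
  by rewrite H.
rewrite !(mulnC (p ^ a)%N) !(addnC _ (_ * p ^ a)%N) !modnMDl modn_mod (modn_small hxi) => e.
split; apply/eqP => //; move: H; rewrite e => /addnI/eqP.
by rewrite eqn_pmul2l// => /eqP.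
Qed.

Lemma big_modn_refine (I : finType) (V : nmodType) (c : I -> nat) (G : I -> V) a d xi :
  (xi < p ^ a)%N ->
  \sum_(i | (c i %% p ^ a == xi)%N) G i =
  \sum_(v < (p ^ d)%N) \sum_(i | (c i %% p ^ (a + d) == xi + p ^ a * v)%N) G i.
Proof.
move=> hxi.
have h : (0 < p ^ d)%N by rewrite expn_gt0 p_gt0.
rewrite (partition_big (fun i => Ordinal (ltn_pmod (c i %/ p ^ a) h)) predT)//=.
apply: eq_bigr => v _; apply: eq_bigl => i.
by rewrite modn_expn_refine// -val_eqE.
Qed.

End ResidueClasses.

(** * Decoupling inequalities over residue classes *)

Section Setting.
Variables (R : realType) (p : nat).

Section Data.
Variables (T X : finType) (w : T -> R) (f : X -> T -> R[i]) (pos : X -> nat).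

(* The only consequence of the orthogonality of characters that is used. Unlike a bound
   on one mean value, it survives dilation of a residue class and multiplication of the
   weight by |exponential sum|^(2 M). *)
Definition orthogonal_mod k H := forall xs ys : seq X, size xs = size ys ->
  \sum_g (w g)%:C%C * (\prod_(x <- xs) f x g) * (\prod_(y <- ys) (f y g)^*%C) != 0 ->
  forall j, (j <= k)%N -> (\sum_(x <- xs) pos x ^ j = \sum_(y <- ys) pos y ^ j %[mod p ^ H])%N.

Definition piece a (xi : nat) g : R[i] := \sum_(x | (pos x %% p ^ a == xi)%N) f x g.

End Data.

Definition mass n (lam : nat -> R) a (xi : nat) : R := \sum_(z < (p ^ n)%N | (z %% p ^ a == xi)%N) lam z.

(* Half of the critical exponent k (k + 1). *)
Definition crit k : nat := 'C(k.+1, 2).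

(* [lam z] bounds the square of the L^(2 crit k) norm of the piece over z, so that
   [decoupling] is an l^2 decoupling inequality with constant D^(1 / crit k). *)
Definition admissible k n (T X : finType) (w : T -> R) (f : X -> T -> R[i]) (pos : X -> nat)
    (lam : nat -> R) :=
  [/\ forall g, 0 <= w g, orthogonal_mod w f pos k (k * n), forall z, (z < p ^ n)%N -> 0 < lam z &
   forall z, (z < p ^ n)%N ->
     \sum_g w g * csq (piece f pos n z g) ^+ crit k <= lam z ^+ crit k].

(** [T] with the weight [w] stands for the torus with its measure. One constant serves all systems,
    so it applies unchanged to a dilated residue class and to a modified weight. *)
Definition decoupling k n (D : R) :=
  forall (T X : finType) (w : T -> R) (f : X -> T -> R[i]) (pos : X -> nat) (lam : nat -> R),
  admissible k n w f pos lam ->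
  \sum_g w g * csq (piece f pos 0 0 g) ^+ crit k <= D * mass n lam 0 0 ^+ crit k.

End Setting.

(** * Congruences between power sums *)

Section PowerSums.

(* With m = k - l + 1, the polynomial [f] below is the multiple of (X + d)^m with
   derivative k! (X + d)^(m-1) X^i: its coefficients of degrees 1, ..., i vanish,
   and that of degree i + 1 is prime to p. *)
Lemma dvdz_moments_of_shifted (p k l H : nat) (d : int) (M : nat -> int) :
  prime p -> (k < p)%N -> (0 < l <= k)%N -> ~~ (p%:Z %| d)%Z -> M 0%N = 0 ->
  (forall i, (l < i <= k)%N -> ((p ^ H)%N%:Z %| M i)%Z) ->
  (forall j, (k - l < j <= k)%N ->
     ((p ^ H)%N%:Z %| (\sum_(i < k.+1) (('X + d%:P) ^+ j)`_i * M i)%R)%Z) ->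
  forall i, (0 < i <= k)%N -> ((p ^ H)%N%:Z %| M i)%Z.
Proof.
move=> pp kp /andP[l0 lk] pd M0 Ml Mj.
set q := (p ^ H)%N%:Z.
have cop (x y : int) : ~~ (p%:Z %| x)%Z -> (q %| (x * y)%R)%Z -> (q %| y)%Z.
  move=> px; rewrite Gauss_dvdzr//.
  rewrite /coprimez /= /gcdz /q absz_nat -[_ == _]/(coprime (p ^ H)%N `|x|%N).
  by rewrite coprimeXl// prime_coprime.
have kfact : ~~ (p%:Z %| (k`!)%:Z)%Z.
  have : forall n, (n < p)%N -> ~~ (p %| n`!)%N.
    elim=> [|n IH] h; first by rewrite fact0 dvdn1; case: p pp {pd kp cop q Ml Mj h} => [|[]].
    rewrite factS Euclid_dvdM// negb_or IH ?andbT; last exact: ltnW.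
    by apply: contraL h => /dvdn_leq; rewrite -leqNgt; apply.
  exact.
(* Downward induction on i: in the linear relation given by [f], the moments below i have
   coefficient 0 and those above i are already known to be divisible. *)
suff H0 : forall c i, (k - i < c)%N -> (0 < i <= k)%N -> (q %| M i)%Z.
  by move=> i; exact: (H0 (k - i).+1).
elim=> [//|c IH] [//|i] hc /andP[_ ik].
case: (ltnP l i.+1) => [li|il]; first by apply: Ml; rewrite li.
pose m := (k - l).+1; pose Y : {poly int} := 'X + d%:P.
pose f := \sum_(s < i.+1) ('C(i, s)%:Z * (- d) ^+ (i - s) * (k`! %/ (m + s))%:Z) *: Y ^+ (m + s).
have Y' : Y^`() = 1 by rewrite derivD derivX derivC addr0.
have f' : f^`() = (k`!)%:Z *: (Y ^+ m.-1 * 'X^i).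
  have -> : 'X^i = \sum_(s < i.+1) ((- d) ^+ (i - s) * 'C(i, s)%:Z) *: Y ^+ s.
    have {1}-> : 'X = - d%:P + Y by rewrite /Y addrC addrK.
    rewrite exprDn; apply: eq_bigr => s _.
    by rewrite -polyCN -polyC_exp mul_polyC -scaler_nat scalerA mulrC natz.
  rewrite mulr_sumr scaler_sumr raddf_sum; apply: eq_bigr => s _ /=.
  rewrite derivZ deriv_exp Y' mul1r -scaler_nat scalerA.
  have -> : ('C(i, s)%:Z * (- d) ^+ (i - s) * (k`! %/ (m + s))%:Z * (m + s)%:R)%R
     = (k`!)%:Z * ((- d) ^+ (i - s) * 'C(i, s)%:Z).
    have : ((k`! %/ (m + s))%:Z * (m + s)%:R)%R = (k`!)%:Z.
      rewrite natz -PoszM divnK// dvdn_fact// /m; have := ltn_ord s; lia.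
    by move=> <-; ring.
  by rewrite addSn /= exprD -scalerAr scalerA.
have fc j : f`_j.+1 * j.+1%:Z = (k`!)%:Z * (Y ^+ m.-1 * 'X^i)`_j.
  by rewrite -coefZ -f' coef_deriv -natz mulr_natr.
have f0 j : (0 < j <= i)%N -> f`_j = 0.
  case: j => [//|j] /andP[_ ji]; apply/eqP.
  have /eqP := fc j; rewrite coefMXn ji mulr0 mulf_eq0 => /orP[//|].
  by [].
have fi : ~~ (p%:Z %| f`_i.+1)%Z.
  apply: contra kfact => h.
  have := dvdz_mulr i.+1%:Z h; rewrite fc coefMXn ltnn subnn.
  have -> : (Y ^+ m.-1)`_0 = d ^+ m.-1.
    by rewrite -horner_coef0 horner_exp /Y !hornerE.
  rewrite !dvdzE abszM Euclid_dvdM// abszX; case/orP => //.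
  by rewrite Euclid_dvdX// => /andP[h2]; move: pd; rewrite dvdzE h2.
have Lf : (q %| (\sum_(j < k.+1) f`_j * M j)%R)%Z.
  have -> : \sum_(j < k.+1) f`_j * M j =
      \sum_(s < i.+1) ('C(i, s)%:Z * (- d) ^+ (i - s) * (k`! %/ (m + s))%:Z)
       * \sum_(j < k.+1) (Y ^+ (m + s))`_j * M j.
    under [RHS]eq_bigr do rewrite mulr_sumr.
    rewrite exchange_big /=; apply: eq_bigr => j _.
    rewrite /f coef_sum mulr_suml; apply: eq_bigr => s _.
    by rewrite coefZ mulrA.
  apply: rpred_sum => s _; apply: dvdz_mull; apply: Mj.
  by rewrite /m; have := ltn_ord s; lia.
apply: (cop f`_i.+1) => //.
have ik' : (i.+1 < k.+1)%N by [].
move: Lf; rewrite (bigD1 (Ordinal ik'))//= rpredDr//.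
apply: rpred_sum => j ji; have jk := ltn_ord j.
case: (ltngtP j i.+1) => [ji1|ij|e]; last by move: ji; rewrite -val_eqE /= e eqxx.
  case: (posnP j) => [->|j0]; first by rewrite M0 mulr0 rpred0.
  by rewrite f0 ?mul0r ?rpred0//; lia.
apply: dvdz_mull; apply: IH; lia.
Qed.

Lemma sum_horner_sub (D : nat) (k : nat) (xs ys : seq int) (P : {poly int}) :
  (forall j, (j <= k)%N -> (D%:Z %| (\sum_(x <- xs) x ^+ j - \sum_(y <- ys) y ^+ j)%R)%Z) ->
  (size P <= k.+1)%N -> (D%:Z %| (\sum_(x <- xs) P.[x] - \sum_(y <- ys) P.[y])%R)%Z.
Proof.
move=> h sP.
have E (zs : seq int) : \sum_(z <- zs) P.[z] = \sum_(i < k.+1) P`_i * \sum_(z <- zs) z ^+ i.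
  under eq_bigr do rewrite (horner_coef_wide _ sP).
  by rewrite exchange_big; apply: eq_bigr => i _; rewrite mulr_sumr.
rewrite !E -sumrB; apply: rpred_sum => i _.
by rewrite -mulrBr; apply/dvdz_mull/h; rewrite -ltnS.
Qed.

(** About eta, the terms of [us] and [vs] vanish mod p^H in degrees above k - l, which leaves
    relations between [xs] and [ys] alone. Expanding (X + xi - eta)^j turns them into relations
    between moments about xi, and those of degree above l vanish. *)
Lemma dvdz_power_sums_shift (p k l a b H : nat) (xi eta : int) (xs ys us vs : seq int) :
  prime p -> (k < p)%N -> (0 < l <= k)%N -> ~~ (p%:Z %| (xi - eta)%R)%Z ->
  size xs = size ys -> size us = size vs ->
  {in xs ++ ys, forall x, ((p ^ a)%N%:Z %| (x - xi)%R)%Z} ->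
  {in us ++ vs, forall u, ((p ^ b)%N%:Z %| (u - eta)%R)%Z} ->
  (H <= b * (k - l).+1)%N -> (H <= l.+1 * a)%N ->
  (forall j, (j <= k)%N ->
    ((p ^ H)%N%:Z %| (\sum_(x <- xs ++ us) x ^+ j - \sum_(y <- ys ++ vs) y ^+ j)%R)%Z) ->
  forall i, (i <= k)%N ->
    ((p ^ H)%N%:Z %| (\sum_(x <- xs) (x - xi) ^+ i - \sum_(y <- ys) (y - xi) ^+ i)%R)%Z.
Proof.
move=> pp kp /andP[l0 lk] pd sxy suv hx hu Hb Ha hj.
pose M i := \sum_(x <- xs) (x - xi) ^+ i - \sum_(y <- ys) (y - xi) ^+ i.
have pw (c e : nat) (x : int) : (H <= c * e)%N -> ((p ^ c)%N%:Z %| x)%Z ->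
    ((p ^ H)%N%:Z %| (x ^+ e)%R)%Z.
  move=> ce cx; apply: (@dvdz_trans ((p ^ c)%N%:Z ^+ e)); last first.
    by rewrite dvdzE !abszX dvdn_exp2r.
  by rewrite dvdzE abszX !absz_nat -expnM dvdn_exp2l.
have M0 : M 0%N = 0.
  rewrite /M; under eq_bigr do rewrite expr0.
  under [X in _ - X]eq_bigr do rewrite expr0.
  by rewrite !big_const_seq !count_predT sxy subrr.
have sub1 (c e : nat) (zs zs' : seq int) (z : int) : (H <= c * e)%N ->
    {in zs ++ zs', forall x, ((p ^ c)%N%:Z %| (x - z)%R)%Z} ->
    ((p ^ H)%N%:Z %| (\sum_(x <- zs) (x - z) ^+ e - \sum_(y <- zs') (y - z) ^+ e)%R)%Z.
  move=> ce hz; apply: rpredB; rewrite big_seq; apply: rpred_sum => x xz; apply: pw ce _; apply: hz;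
    by rewrite mem_cat xz ?orbT.
suff H1 i : (0 < i <= k)%N -> ((p ^ H)%N%:Z %| M i)%Z.
  by move=> i ik; case: (posnP i) => [->|i0]; [rewrite -/(M 0%N) M0 dvdz0 | apply: H1; rewrite i0].
apply: (@dvdz_moments_of_shifted p k l H (xi - eta)) => //; first by rewrite l0.
  move=> {}i /andP[li ik]; apply: (sub1 a) => //.
  by apply: leq_trans Ha _; rewrite mulnC leq_mul2l li orbT.
move=> j /andP[lj jk].
set Q : {poly int} := ('X + (xi - eta)%:P) ^+ j.
have sQ : (size Q <= k.+1)%N.
  rewrite /Q; have -> : 'X + (xi - eta)%:P = 'X - (eta - xi)%:P by rewrite -polyCN opprB.
  by rewrite size_exp_XsubC ltnS.
have -> : \sum_(i0 < k.+1) Q`_i0 * M i0 =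
   \sum_(x <- xs) (x - eta) ^+ j - \sum_(y <- ys) (y - eta) ^+ j.
  have E (zs : seq int) : \sum_(z <- zs) (z - eta) ^+ j =
      \sum_(i < k.+1) Q`_i * \sum_(z <- zs) (z - xi) ^+ i.
    have E1 z : (z - eta) ^+ j = Q.[z - xi].
      by rewrite /Q horner_exp hornerD hornerX hornerC addrA subrK.
    under eq_bigr do rewrite E1 (horner_coef_wide _ sQ).
    by rewrite exchange_big; apply: eq_bigr => i' _; rewrite mulr_sumr.
  by rewrite !E -sumrB; apply: eq_bigr => i' _; rewrite mulrBr.
have := @sum_horner_sub (p ^ H) k (xs ++ us) (ys ++ vs) (('X - eta%:P) ^+ j) hj.
rewrite size_exp_XsubC ltnS => /(_ jk).
have E (zs : seq int) : \sum_(z <- zs) (('X - eta%:P) ^+ j).[z] = \sum_(z <- zs) (z - eta) ^+ j.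
  by apply: eq_bigr => z _; rewrite horner_exp hornerXsubC.
rewrite !E !big_cat /= opprD addrACA rpredDr//.
apply: (sub1 b) => //; apply: leq_trans Hb _.
by rewrite leq_mul2l; apply/orP; right; lia.
Qed.
End PowerSums.

Lemma sum_neq0 (I : finType) (V : nmodType) (F : I -> V) : \sum_i F i != 0 -> exists i, F i != 0.
Proof.
move=> h; case: (pickP (fun i => F i != 0)) => [i hi|h0]; first by exists i.
by move: h; rewrite big1 ?eqxx// => i _; have /negbFE/eqP := h0 i.
Qed.

Lemma eqn_mod_dvdz (m n d : nat) : (m = n %[mod d])%N <-> (d%:Z %| (m%:Z - n%:Z)%R)%Z.
Proof.
rewrite -eqz_mod_dvd !modz_nat; split => [->//|/eqP[//]].
Qed.

Lemma sum_pow_int (X : Type) (c : X -> nat) (xs : seq X) j :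
  (\sum_(x <- xs) c x ^ j)%N%:Z = \sum_(z <- [seq (c x)%:Z | x <- xs]) z ^+ j.
Proof. by rewrite big_map -natz natr_sum; apply: eq_bigr => x _; rewrite natrX natz. Qed.

(** * Dilation of a residue class and passage to lower degree *)

Section Rescaling.
Variables (R : realType) (p : nat).
Hypothesis p_gt0 : (0 < p)%N.
Variables (T X : finType) (w : T -> R) (f : X -> T -> R[i]) (pos : X -> nat).

(** Extension by zero keeps the index type [X]; together with the positions [pos x %/ p ^ a] it
    describes the class dilated to all naturals. *)
Definition restrict_class a (xi : nat) : X -> T -> R[i] :=
  fun x g => if (pos x %% p ^ a == xi)%N then f x g else 0.

Lemma prod_restrict a xi g (xs : seq X) :
  \prod_(x <- xs) restrict_class a xi x g =
  if all (fun x => pos x %% p ^ a == xi)%N xs then \prod_(x <- xs) f x g else 0.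
Proof.
elim: xs => [|x xs IH]; first by rewrite !big_nil.
rewrite !big_cons IH /= /restrict_class; case: eqP => _ /=; last by rewrite mul0r.
by case: ifP; rewrite ?mulr0.
Qed.

Lemma prod_restrictJ a xi g (xs : seq X) :
  \prod_(x <- xs) (restrict_class a xi x g)^*%C =
  if all (fun x => pos x %% p ^ a == xi)%N xs then \prod_(x <- xs) (f x g)^*%C else 0.
Proof.
by rewrite -!rmorph_prod prod_restrict; case: ifP => _ //; rewrite raddf0.
Qed.

Lemma piece_restrict a xi d v g : (xi < p ^ a)%N -> (v < p ^ d)%N ->
  piece p (restrict_class a xi) (fun x => pos x %/ p ^ a)%N d v g =
  piece p f pos (a + d)%N (xi + p ^ a * v)%N g.
Proof.
move=> hxi hv; rewrite /piece [LHS]big_mkcond [RHS]big_mkcond; apply: eq_bigr => x _.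
by rewrite modn_expn_refine// /restrict_class; case: eqP; case: eqP.
Qed.

Lemma piece_restrict0 a xi g : (xi < p ^ a)%N ->
  piece p (restrict_class a xi) (fun x => pos x %/ p ^ a)%N 0 0 g = piece p f pos a xi g.
Proof. by move=> hxi; rewrite piece_restrict// addn0 muln0 addn0. Qed.

Lemma piece_expr b eta g m :
  piece p f pos b eta g ^+ m = \sum_(u : {ffun 'I_m -> X}) \prod_(x <- codom u) restrict_class b eta x g.
Proof.
rewrite /piece big_mkcond /= -[m in LHS]card_ord -prodr_const bigA_distr_bigA /=.
by apply: eq_bigr => u _; rewrite /codom /image_mem big_map big_enum.
Qed.

(** Power sums about xi are p^(a j) times those of the dilated positions. Cancelling this factor
    leaves the modulus p^(k n - a j), a multiple of p^(k (n - a)) for j <= k; this fixes the modulus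
    p^(k n) in [admissible]. *)
Lemma orthogonal_mod_rescale k n a xi : (a <= n)%N -> (xi < p ^ a)%N ->
  orthogonal_mod p w f pos k (k * n) ->
  orthogonal_mod p w (restrict_class a xi) (fun x => pos x %/ p ^ a)%N k (k * (n - a)).
Proof.
move=> an hxi ho xs ys sxy.
under eq_bigr do rewrite prod_restrict prod_restrictJ.
case hx: (all _ xs); last by rewrite big1 ?eqxx// => g _; rewrite mulr0 mul0r.
case hy: (all _ ys); last by rewrite big1 ?eqxx// => g _; rewrite mulr0.
move=> /(ho _ _ sxy) h j jk.
apply/eqn_mod_dvdz.
have := @sum_horner_sub (p ^ (k * n)) k
  [seq (pos x)%:Z | x <- xs] [seq (pos x)%:Z | x <- ys] (('X - (xi%:Z)%:P) ^+ j).
rewrite size_exp_XsubC ltnS jk => /(_ _ isT).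
have E (zs : seq X) : all (fun x => pos x %% p ^ a == xi)%N zs ->
    \sum_(z <- [seq (pos x)%:Z | x <- zs]) (('X - (xi%:Z)%:P) ^+ j).[z] =
    (p ^ (a * j))%N%:Z * (\sum_(x <- zs) (pos x %/ p ^ a) ^ j)%N%:Z.
  move=> /allP hz; rewrite (@sum_pow_int _ (fun x => pos x %/ p ^ a)%N) !big_map mulr_sumr.
  apply: eq_big_seq => x /hz/eqP xz; rewrite horner_exp hornerXsubC.
  have -> : (pos x)%:Z - xi%:Z = (p ^ a)%N%:Z * (pos x %/ p ^ a)%N%:Z.
    rewrite [in LHS](divn_eq (pos x) (p ^ a)%N) xz; lia.
  by rewrite exprMn expnM -!natz !natrX !natz.
rewrite !E// -mulrBr => H.
have {H} := H _; have -> : (p ^ (k * n))%N = (p ^ (a * j) * p ^ (k * n - a * j))%N.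
  by rewrite -expnD subnKC// mulnC leq_mul.
have {}h i : (i <= k)%N -> ((p ^ (a * j) * p ^ (k * n - a * j))%N%:Z %|
    (\sum_(x <- [seq (pos x)%:Z | x <- xs]) x ^+ i - \sum_(y <- [seq (pos x)%:Z | x <- ys]) y ^+ i)%R)%Z.
  by move=> ik; rewrite -expnD subnKC ?(mulnC a) ?leq_mul// -!(@sum_pow_int _ pos); apply/eqn_mod_dvdz/h.
move=> /(_ h); rewrite PoszM dvdz_mul2l ?eqz_nat ?expn_eq0 ?(eqn0Ngt p) ?p_gt0//.
move=> H; apply: dvdz_trans H.
by rewrite dvdzE !absz_nat dvdn_exp2l// mulnBr leq_sub2l// mulnC leq_mul2r jk orbT.
Qed.

(* When the power of [csq] is expanded, the new terms come from the class of eta mod p^b: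
   after a shift by eta their j-th power sums are divisible by p^(b j). *)
Lemma orthogonal_mod_lower_degree (c : R) k l K a b xi eta e M :
  prime p -> (k < p)%N -> (0 < l <= k)%N ->
  (xi < p ^ a)%N -> (xi != eta %[mod p])%N ->
  (l * (a + e) <= b * (k - l).+1)%N -> (l * (a + e) <= l.+1 * a)%N -> (l * (a + e) <= K)%N ->
  orthogonal_mod p w f pos k K ->
  orthogonal_mod p (fun g => c * w g * csq (piece p f pos b eta g) ^+ M)
    (restrict_class a xi) (fun x => pos x %/ p ^ a)%N l (l * e).
Proof.
move=> pp kp l0k hxi hpd Hb Ha HK ho xs ys sxy.
have E g : (c * w g * csq (piece p f pos b eta g) ^+ M)%:C%C * 
     (\prod_(x <- xs) restrict_class a xi x g) *
     (\prod_(y <- ys) (restrict_class a xi y g)^*%C) =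
   c%:C%C * \sum_(u : {ffun 'I_M -> X}) \sum_(v : {ffun 'I_M -> X})
    (w g)%:C%C * (\prod_(x <- xs) restrict_class a xi x g) *
   (\prod_(x <- codom u) restrict_class b eta x g) *
   ((\prod_(y <- ys) (restrict_class a xi y g)^*%C) *
    \prod_(y <- codom v) (restrict_class b eta y g)^*%C).
  rewrite !rmorphM rmorphXn /= csqE exprMn -rmorphXn !piece_expr rmorph_sum /=.
  rewrite mulr_suml mulr_sumr !mulr_suml mulr_sumr; apply: eq_bigr => u _.
  rewrite !mulr_sumr !mulr_suml; apply: eq_bigr => v _.
  rewrite rmorph_prod /=; ring.
under eq_bigr do rewrite E.
rewrite -mulr_sumr mulf_eq0 negb_or => /andP[_].
(* A nonzero weighted sum has a nonzero term (u, v) in the expansion of the weight; orthogonality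
   applies to it with the longer lists [xs ++ codom u] and [ys ++ codom v]. *)
rewrite exchange_big /= => /sum_neq0[u]; rewrite exchange_big /= => /sum_neq0[v].
under eq_bigr do rewrite !prod_restrict !prod_restrictJ.
case: (boolP (all _ xs)) => [/allP hx|_]; last by rewrite big1 ?eqxx// => g _; rewrite mulr0 !mul0r.
case: (boolP (all _ (codom u))) => [/allP hu|_]; last
  by rewrite big1 ?eqxx// => g _; rewrite mulr0 !mul0r.
case: (boolP (all _ ys)) => [/allP hy|_]; last by rewrite big1 ?eqxx// => g _; rewrite mul0r mulr0.
case: (boolP (all _ (codom v))) => [/allP hv|_]; last by rewrite big1 ?eqxx// => g _; rewrite !mulr0.
under eq_bigr do rewrite -[_ * _ * \prod_(x <- codom u) _]mulrA -!big_cat.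
have suv : size (codom u) = size (codom v) by rewrite !size_codom.
have sxy' : size (xs ++ codom u) = size (ys ++ codom v) by rewrite !size_cat sxy suv.
move=> /(ho _ _ sxy') h j jl.
have pa (x : X) : (pos x %% p ^ a = xi)%N -> (pos x)%:Z - xi%:Z = (p ^ a)%N%:Z * (pos x %/ p ^ a)%N%:Z.
  move=> xz; rewrite [in LHS](divn_eq (pos x) (p ^ a)%N) xz; lia.
have pb (x : X) : (pos x %% p ^ b = eta)%N -> (pos x)%:Z - eta%:Z = (p ^ b)%N%:Z * (pos x %/ p ^ b)%N%:Z.
  move=> xz; rewrite [in LHS](divn_eq (pos x) (p ^ b)%N) xz; lia.
have /andP[l0 lk] := l0k.
have hpd' : ~~ (p%:Z %| (xi%:Z - eta%:Z)%R)%Z by apply/negP => /eqn_mod_dvdz/eqP; apply/negP.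
have := @dvdz_power_sums_shift p k l a b (l * (a + e)) xi eta
  [seq (pos x)%:Z | x <- xs] [seq (pos x)%:Z | x <- ys]
  [seq (pos x)%:Z | x <- codom u] [seq (pos x)%:Z | x <- codom v] pp kp l0k.
have sxy2 : size [seq (pos x)%:Z | x <- xs] = size [seq (pos x)%:Z | x <- ys] by rewrite !size_map.
have suv2 : size [seq (pos x)%:Z | x <- codom u] = size [seq (pos x)%:Z | x <- codom v]
  by rewrite !size_map.
move=> /(_ hpd' sxy2 suv2).
move=> H; have {}H := H _ _ Hb Ha _ j (leq_trans jl lk).
apply/eqn_mod_dvdz.
have {H} : ((p ^ (l * (a + e)))%N%:Z %| ((p ^ (a * j))%N%:Z *
   ((\sum_(x <- xs) (pos x %/ p ^ a) ^ j)%N%:Z - (\sum_(x <- ys) (pos x %/ p ^ a) ^ j)%N%:Z))%R)%Z.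
  have E1 (zs : seq X) : all (fun x => pos x %% p ^ a == xi)%N zs ->
    \sum_(z <- [seq (pos x)%:Z | x <- zs]) (z - xi%:Z) ^+ j =
    (p ^ (a * j))%N%:Z * (\sum_(x <- zs) (pos x %/ p ^ a) ^ j)%N%:Z.
    move=> /allP hz; rewrite (@sum_pow_int _ (fun x => pos x %/ p ^ a)%N) !big_map mulr_sumr.
    apply: eq_big_seq => x /hz/eqP xz; rewrite pa//.
    by rewrite exprMn expnM -!natz !natrX !natz.
  rewrite mulrBr -!E1; try exact/allP.
  apply: H.
  - move=> z; rewrite mem_cat => /orP[] /mapP[x xz ->]; rewrite pa ?dvdz_mulr//;
      apply/eqP; first [exact: hx | exact: hy].
  - move=> z; rewrite mem_cat => /orP[] /mapP[x xz ->]; rewrite pb ?dvdz_mulr//;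
      apply/eqP; first [exact: hu | exact: hv].
  - move=> i ik; rewrite -!map_cat -!(@sum_pow_int _ pos); apply/eqn_mod_dvdz.
    by have := h i ik => /(congr1 (modn^~ (p ^ (l * (a + e)))%N)); rewrite !modn_dvdm// dvdn_exp2l.
have -> : (p ^ (l * (a + e)))%N = (p ^ (a * j) * p ^ (l * (a + e) - a * j))%N.
  rewrite -expnD subnKC//; nia.
rewrite PoszM dvdz_mul2l ?eqz_nat ?expn_eq0 ?(eqn0Ngt p) ?p_gt0// => /(dvdz_trans _); apply.
rewrite dvdzE !absz_nat dvdn_exp2l//; nia.
Qed.
End Rescaling.

Lemma crit_mul2 k : (2 * crit k = k.+1 * k)%N.
Proof. by rewrite /crit -mul_bin_diag bin1. Qed.

Lemma leq_crit l k : (l <= k)%N -> (crit l <= crit k)%N.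
Proof. by move=> lk; apply: leq_bin2l. Qed.

Lemma crit_gt0 l : (0 < l)%N -> (0 < crit l)%N.
Proof. by case: l => // l _; rewrite bin_gt0. Qed.

Lemma critS l : crit l.+1 = (crit l + l.+1)%N.
Proof. by rewrite /crit binS bin1. Qed.

Lemma crit_add m l : crit (m + l) = (crit m + m * l + crit l)%N.
Proof.
elim: l => [|l IH]; first by rewrite muln0 !addn0.
by rewrite addnS !critS IH mulnS; ring.
Qed.

(** * Bilinear integrals over two residue classes *)

Section Bilinear.
Variables (R : realType) (p : nat).
Hypothesis p_prime : prime p.
Let p_gt0 : (0 < p)%N := prime_gt0 p_prime.

Lemma mass_refine n (lam : nat -> R) a d xi : (xi < p ^ a)%N ->
  mass p n lam a xi = \sum_(v < (p ^ d)%N) mass p n lam (a + d)%N (xi + p ^ a * v)%N.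
Proof. by move=> hxi; rewrite /mass (big_modn_refine p_gt0 (fun z : 'I_(p ^ n) => z : nat) _ d hxi). Qed.

Lemma piece_refine (T X : finType) (f : X -> T -> R[i]) pos a d xi g : (xi < p ^ a)%N ->
  piece p f pos a xi g = \sum_(v < (p ^ d)%N) piece p f pos (a + d)%N (xi + p ^ a * v)%N g.
Proof. by move=> hxi; rewrite /piece (big_modn_refine p_gt0 pos _ d hxi). Qed.

Lemma mass00 n (lam : nat -> R) : mass p n lam 0 0 = \sum_(v < (p ^ n)%N) lam v.
Proof. by rewrite /mass; apply: eq_bigl => v; rewrite expn0 modn1. Qed.

Lemma mass_full n (lam : nat -> R) z : (z < p ^ n)%N -> mass p n lam n z = lam z.
Proof.
move=> hz; rewrite /mass (big_pred1 (Ordinal hz))// => v.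
by rewrite modn_small// -val_eqE.
Qed.

Lemma mass_ge0 n (lam : nat -> R) a xi :
  (forall z, (z < p ^ n)%N -> 0 < lam z) -> 0 <= mass p n lam a xi.
Proof. by move=> h; apply: sumr_ge0 => v _; apply/ltW/h. Qed.

Lemma mass_gt0 n (lam : nat -> R) a xi : (forall z, (z < p ^ n)%N -> 0 < lam z) ->
  (a <= n)%N -> (xi < p ^ a)%N -> 0 < mass p n lam a xi.
Proof.
move=> h an hxi; have hz : (xi < p ^ n)%N by apply: leq_trans hxi _; rewrite leq_pexp2l.
rewrite /mass (bigD1 (Ordinal hz))/= ?modn_small//.
by rewrite ltr_pwDl ?h// sumr_ge0// => v _; apply/ltW/h.
Qed.

Lemma addn_mulpow_lt a d xi v : (xi < p ^ a)%N -> (v < p ^ d)%N -> (xi + p ^ a * v < p ^ (a + d))%N.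
Proof. by move=> h1 h2; rewrite expnD; nia. Qed.

Section Context.
Variables (k n : nat) (T X : finType) (w : T -> R) (f : X -> T -> R[i]) (pos : X -> nat).
Variable lam : nat -> R.
Hypothesis adm : admissible p k n w f pos lam.

Notation F := (piece p f pos).
Notation Lam := (mass p n lam).

Let w_ge0 g : 0 <= w g. Proof. by case: adm. Qed.
Let lam_gt0 z : (z < p ^ n)%N -> 0 < lam z. Proof. by case: adm => _ _ h _; exact: h. Qed.

Definition bilinear_bound l a b (A : R) := forall xi eta, (xi < p ^ a)%N -> (eta < p ^ b)%N ->
  (xi != eta %[mod p])%N ->
  \sum_g w g * (csq (F a xi g) ^+ crit l * csq (F b eta g) ^+ (crit k - crit l)) <=
  A * (Lam a xi ^+ crit l * Lam b eta ^+ (crit k - crit l)).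

Lemma bilinear_bound_le l a b A B : A <= B -> bilinear_bound l a b A -> bilinear_bound l a b B.
Proof.
move=> AB h xi eta hxi heta ne; apply: le_trans (h _ _ hxi heta ne) _.
by rewrite ler_wpM2r// mulr_ge0// exprn_ge0// mass_ge0.
Qed.

(** The dilated class is itself an admissible system, with n - a scales left. *)
Lemma piece_moment D a xi : decoupling p k (n - a) D -> (a <= n)%N -> (xi < p ^ a)%N ->
  \sum_g w g * csq (F a xi g) ^+ crit k <= D * Lam a xi ^+ crit k.
Proof.
move=> dec an hxi; case: adm => hw ho hl hm.
pose lam' v := Lam (a + (n - a))%N (xi + p ^ a * v)%N.
have hlt v : (v < p ^ (n - a))%N -> (xi + p ^ a * v < p ^ n)%N.
  by move=> /(addn_mulpow_lt hxi); rewrite subnKC.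
have := dec T X w (restrict_class p f pos a xi) (fun x => pos x %/ p ^ a)%N lam' _.
rewrite mass00 -mass_refine//; under eq_bigr do rewrite piece_restrict0//; apply.
split => //.
- exact: orthogonal_mod_rescale.
- by move=> z hz; rewrite /lam' subnKC// mass_full ?hlt// hl// hlt.
- move=> z hz; rewrite /lam' subnKC// mass_full ?hlt//.
  under eq_bigr do rewrite piece_restrict// subnKC//.
  by apply: hm; exact: hlt.
Qed.

(** As [crit 0] is 0, only the class of eta is present, and it has n - b scales. *)
Lemma bilinear_bound0 D a b : decoupling p k (n - b) D -> (b <= n)%N -> bilinear_bound 0 a b D.
Proof.
move=> dec bn xi eta hxi heta _; rewrite /= -[crit 0]/0%N subn0 !expr0 mul1r.
by under eq_bigr do rewrite mul1r; exact: piece_moment.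
Qed.

Lemma bilinear_bound_base D D' l a b : (l <= k)%N ->
  decoupling p k (n - a) D -> decoupling p k (n - b) D' ->
  (a <= n)%N -> (b <= n)%N -> bilinear_bound l a b (D + D').
Proof.
move=> lk deca decb an bn xi eta hxi heta _.
have L1 : 0 < Lam a xi by exact: mass_gt0.
have L2 : 0 < Lam b eta by exact: mass_gt0.
have qE : crit k = (crit l + (crit k - crit l))%N by rewrite subnKC// leq_crit.
set q' := (crit k - crit l)%N in qE *.
rewrite -ler_pdivrMr ?mulr_gt0 ?exprn_gt0// mulr_suml.
apply: (@le_trans _ _ (\sum_g (w g * csq (F a xi g) ^+ crit k / Lam a xi ^+ crit k +
    w g * csq (F b eta g) ^+ crit k / Lam b eta ^+ crit k))).
  apply: ler_sum => g _.
  have X0 : 0 <= csq (F a xi g) / Lam a xi by rewrite divr_ge0 ?csq_ge0// ltW.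
  have Y0 : 0 <= csq (F b eta g) / Lam b eta by rewrite divr_ge0 ?csq_ge0// ltW.
  have := exprM_le_exprD (crit l) q' X0 Y0.
  rewrite -qE => /(ler_wpM2l (w_ge0 g)).
  by rewrite mulrDr !expr_div_n mulf_div !mulrA.
rewrite big_split -!mulr_suml lerD// ler_pdivrMr ?exprn_gt0//; exact: piece_moment.
Qed.

(** The identity crit k = crit (k - l) + (k - l) l + crit l makes the exponents of both classes
    agree, with weight 1 on the exchanged form and k - l on the form of degree l - 1. Each form is
    divided by its bound, so that a pointwise arithmetic-geometric mean inequality can be summed. *)
Lemma bilinear_bound_holder l a b A A1 A2 : (0 < l <= k)%N -> (a <= n)%N -> (b <= n)%N ->
  0 < A1 -> 0 < A2 -> 0 < A ->
  A1 * A2 ^+ (k - l) = A ^+ (k - l).+1 ->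
  bilinear_bound (k - l) b a A1 -> bilinear_bound l.-1 a b A2 -> bilinear_bound l a b A.
Proof.
move=> /andP[l0 lk] an bn A10 A20 A0 hA h1 h2 xi eta hxi heta ne.
have L1 : 0 < Lam a xi by exact: mass_gt0.
have L2 : 0 < Lam b eta by exact: mass_gt0.
have := h1 _ _ heta hxi; rewrite eq_sym ne => /(_ isT).
have := h2 _ _ hxi heta ne.
have d1 := leq_crit lk; have d2 : (crit l.-1 <= crit k)%N by apply: leq_crit; lia.
have d3 : (crit (k - l) <= crit k)%N by apply: leq_crit; lia.
have kE : crit k = (crit (k - l) + (k - l) * l + crit l)%N by rewrite -crit_add subnK.
have lE : crit l = (crit l.-1 + l)%N by rewrite -{1 3}(prednK l0) critS.
have e1 : ((crit k - crit (k - l)) + crit l.-1 * (k - l) = crit l * (k - l).+1)%N.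
  by rewrite kE lE -addnA addKn; ring.
have e2 : (crit (k - l) + (crit k - crit l.-1) * (k - l) = (crit k - crit l) * (k - l).+1)%N.
  rewrite kE addnK lE (addnC (crit l.-1)) addnA addnK; ring.
move: d1 d2 d3 e1 e2 {kE lE}.
set m := (k - l)%N; move: (crit k) (crit l) (crit l.-1) (crit m) => q ql q1 qm d1 d2 d3 e1 e2 I2 I1.
rewrite -/m in hA.
set x := fun g => csq (F a xi g); set y := fun g => csq (F b eta g).
set M1 := A1 * (Lam b eta ^+ qm * Lam a xi ^+ (q - qm)) in I1.
set M2 := A2 * (Lam a xi ^+ q1 * Lam b eta ^+ (q - q1)) in I2.
set M := A * _.
have M10 : 0 < M1 by rewrite !mulr_gt0 ?exprn_gt0.
have M20 : 0 < M2 by rewrite !mulr_gt0 ?exprn_gt0.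
have M0 : 0 < M by rewrite !mulr_gt0 ?exprn_gt0.
have ME : M1 * M2 ^+ m = M ^+ m.+1.
  rewrite /M1 /M2 /M !exprMn -hA -!exprM -e1 -e2 !exprD; ring.
clearbody M M1 M2.
have pt g : (x g ^+ ql * y g ^+ (q - ql) / M) *+ m.+1 <=
   y g ^+ qm * x g ^+ (q - qm) / M1 + (x g ^+ q1 * y g ^+ (q - q1) / M2) *+ m.
  have x0 : 0 <= x g by exact: csq_ge0.
  have y0 : 0 <= y g by exact: csq_ge0.
  apply: weighted_AGM; rewrite ?divr_ge0 ?mulr_ge0 ?exprn_ge0 ?(ltW M10) ?(ltW M20) ?(ltW M0)//.
  rewrite !expr_div_n mulf_div ME le_eqVlt; apply/orP; left; apply/eqP; congr (_ / _).
  rewrite !exprMn -!exprM -e1 -e2 !exprD; ring.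
have : \sum_g w g * ((x g ^+ ql * y g ^+ (q - ql) / M) *+ m.+1) <=
    \sum_g w g * (y g ^+ qm * x g ^+ (q - qm) / M1 + (x g ^+ q1 * y g ^+ (q - q1) / M2) *+ m).
  by apply: ler_sum => g _; rewrite ler_wpM2l.
under eq_bigr do rewrite mulrnAr mulrA.
under [X in _ <= X]eq_bigr do rewrite mulrDr mulrnAr !mulrA.
rewrite big_split /= !sumrMnl -!mulr_suml => H.
have {H} : ((\sum_g w g * (x g ^+ ql * y g ^+ (q - ql))) / M) *+ m.+1 <= 1 + 1 *+ m.
    apply: le_trans H _; apply: lerD; last apply: ler_wMn2r; rewrite ler_pdivrMr// mul1r.
    by move: I1; under eq_bigr do rewrite mulrA.
  by move: I2; under eq_bigr do rewrite mulrA.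
by rewrite -mulrS ler_pMn2r// ler_pdivrMr// mul1r.
Qed.

(** Degree l decoupling of the class of xi, with the power of the other piece absorbed in the
    weight. The assumed bound on the refined classes supplies the norms that enter this
    decoupling. *)
Lemma bilinear_bound_step D A l a b e : (k < p)%N -> (0 < l <= k)%N -> decoupling p l e D -> 0 < A ->
  (0 < a)%N -> (a + e <= n)%N -> (b <= n)%N ->
  (l * (a + e) <= b * (k - l).+1)%N -> (l * (a + e) <= l.+1 * a)%N ->
  bilinear_bound l (a + e) b A -> bilinear_bound l a b (D * A).
Proof.
move=> kp l0k dec A0 a0 an bn Hb Ha h xi eta hxi heta ne; case: adm => hw ho hl hm.
have lk : (l <= k)%N by case/andP: l0k.
have L2 : 0 < Lam b eta by exact: mass_gt0.
set q' := (crit k - crit l)%N.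
(* Dividing the weight by [B] turns the assumed bound into the normalised moment condition of
   [admissible], with the masses of the subclasses as [lam']. *)
pose B := A * Lam b eta ^+ q'.
have B0 : 0 < B by rewrite mulr_gt0// exprn_gt0.
pose lam' v := Lam (a + e)%N (xi + p ^ a * v)%N.
have := dec T X (fun g => B^-1 * w g * csq (F b eta g) ^+ q') (restrict_class p f pos a xi)
  (fun x => pos x %/ p ^ a)%N lam' _.
rewrite mass00 -mass_refine//; under eq_bigr do rewrite piece_restrict0//.
have E (u v : T -> R) : \sum_g B^-1 * w g * u g * v g = B^-1 * \sum_g w g * (v g * u g).
  by rewrite mulr_sumr; apply: eq_bigr => g _; ring.
rewrite E ler_pdivrMl// => H.
rewrite (_ : D * A * _ = B * (D * Lam a xi ^+ crit l)); last by rewrite /B; ring.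
apply: H; split.
- by move=> g; rewrite mulr_ge0 ?mulr_ge0 ?exprn_ge0 ?csq_ge0 ?invr_ge0// ltW.
- apply: (@orthogonal_mod_lower_degree _ _ _ _ _ _ _ _ _ k l (k * n)) => //.
  by apply: leq_mul.
- move=> z hz; apply: mass_gt0 => //; exact: addn_mulpow_lt.
- move=> z hz; under eq_bigr do rewrite piece_restrict//.
  rewrite E ler_pdivrMl//.
  apply: le_trans (h _ _ _ heta _) _; first exact: addn_mulpow_lt.
    (* Since a > 0, a subclass has the same residue mod p and stays distinct from eta. *)
    by rewrite -(prednK a0) expnS -mulnA addnC mulnC modnMDl.
  by rewrite /B /lam' le_eqVlt; apply/orP; left; apply/eqP; ring.
Qed.
End Context.
End Bilinear.

(** * The iteration and its savings *)

Section Gain.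
Variables (R : realType) (k : nat) (h ep : R).

(* The saving in the exponent per unit of [b], after N rounds of the bilinear iteration.
   The first term comes from exchanging the two classes, the last one is the loss from
   the decoupling in lower degree. *)
Fixpoint gain N l : R :=
  if l is l'.+1 then
    if N is N'.+1 then
      gain N' (k - l)%N / l%:R + (k - l)%:R / (k - l).+1%:R * gain N' l' - ep * k%:R
    else 0
  else h.

Lemma gainN0 N : gain N 0 = h.
Proof. by case: N. Qed.

(* Each [gain N j] with [0 < j] occurs with total coefficient 1/(k-j) + (k-j-1)/(k-j) = 1. *)
Lemma sum_gainS N : (0 < k)%N ->
  \sum_(1 <= l < k) gain N.+1 l = \sum_(1 <= l < k) gain N l + (k.-1)%:R * (h / k%:R - ep * k%:R).
Proof.
move=> k0.
have -> : \sum_(1 <= l < k) gain N.+1 l = \sum_(1 <= l < k) gain N (k - l)%N / l%:R +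
   \sum_(1 <= l < k) (k - l)%:R / (k - l).+1%:R * gain N l.-1 - \sum_(1 <= l < k) ep * k%:R.
  by rewrite -big_split -sumrB; apply: eq_big_nat => -[//|l].
rewrite big_nat_rev /= [X in _ + X - _]big_add1.
have E1 : \sum_(1 <= l < k) gain N (k - (1 + k - l.+1))%N / (1 + k - l.+1)%:R =
    \sum_(1 <= l < k) gain N l / (k - l)%:R.
  by apply: eq_big_nat => l /andP[l0 lk]; rewrite add1n subSS subKn// ltnW.
rewrite E1.
have E2 : \sum_(0 <= l < k.-1) (k - l.+1)%:R / (k - l.+1).+1%:R * gain N l.+1.-1 =
  k.-1%:R / k%:R * h + \sum_(1 <= l < k) (k - l.+1)%:R / (k - l)%:R * gain N l.
  transitivity (\sum_(0 <= l < k) (k - l.+1)%:R / (k - l)%:R * gain N l).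
    rewrite -[in RHS](prednK k0) big_nat_recr//= prednK// subnn !mul0r addr0.
    by apply: eq_big_nat => l lk; rewrite subnSK//; lia.
  by rewrite big_ltn// gainN0 subn0 subn1.
rewrite E2 sumr_const_nat subn1 addrCA -big_split /=.
have -> : \sum_(1 <= i < k) (gain N i / (k - i)%:R + (k - i.+1)%:R / (k - i)%:R * gain N i) =
   \sum_(1 <= i < k) gain N i.
  apply: eq_big_nat => i /andP[i0 ik].
  have -> : (k - i)%:R = (k - i.+1)%:R + 1 :> R by rewrite -subnSK// -natr1.
  by field; rewrite natr1 pnatr_eq0.
by rewrite -mulr_natl; field; rewrite pnatr_eq0 -lt0n.
Qed.

(** Some degree reaches the average over 0 < l < k, but it is not known in advance; the iteration
    therefore treats all degrees at once. *)
Lemma gain_unbounded G e0 : (1 < k)%N -> 0 < e0 -> e0 <= h / k%:R - ep * k%:R ->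
  forall N, G <= N%:R * e0 -> exists2 l, (0 < l < k)%N & G <= gain N l.
Proof.
move=> k1 e00 eh N GN.
have S : \sum_(1 <= l < k) gain N l = N%:R * (k.-1%:R * (h / k%:R - ep * k%:R)).
  elim: N {GN} => [|N IH]; last by rewrite sum_gainS ?(ltnW k1)// IH -natr1; ring.
  by rewrite mul0r big_nat big1// => -[|i].
apply: contrapT => H.
have : \sum_(1 <= l < k) gain N l < \sum_(1 <= l < k) G.
  apply: ltr_sum_nat => // l lk; rewrite ltNge; apply/negP => h1; apply: H; exists l => //.
rewrite S sumr_const_nat subn1 -[ltRHS]mulr_natl (mulrCA N%:R) ltr_pM2l ?ltr0n; last by lia.
by rewrite ltNge (le_trans GN)// ler_wpM2l.
Qed.
End Gain.

Section Iteration.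
Variables (R : realType) (p : nat).
Hypothesis p_prime : prime p.
Variables (k n : nat) (T X : finType) (w : T -> R) (f : X -> T -> R[i]) (pos : X -> nat).
Variable lam : nat -> R.
Hypothesis adm : admissible p k n w f pos lam.
Hypothesis kp : (k < p)%N.
Notation bilinear := (bilinear_bound p k n w f pos lam).

Variables (h ep K : R) (m0 : nat).
Hypothesis m0_gt0 : (0 < m0)%N.
Hypothesis h_ge0 : 0 <= h.
Hypothesis ep_ge0 : 0 <= ep.
Hypothesis K_gt0 : 0 < K.
Hypothesis dec_k : forall n', decoupling p k n' (K * expR (h * n'%:R)).
Hypothesis dec_lower : forall l, (0 < l < k)%N -> decoupling p l m0 (expR (ep * m0%:R)).

(** Steps of the fixed length [m0]; l m0 <= a ensures l (a + m0) <= (l + 1) a, and this persists at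
    larger scales. *)
Lemma bilinear_bound_descend A l b t a : (0 < l < k)%N -> 0 < A -> (0 < a)%N -> (l * m0 <= a)%N ->
  (a + t * m0 <= n)%N -> (b <= n)%N -> (l * (a + t * m0) <= b * (k - l).+1)%N ->
  bilinear l (a + t * m0)%N b A -> bilinear l a b (expR (ep * (t * m0)%:R) * A).
Proof.
move=> lk A0; elim: t a => [|t IH] a a0 ha an bn hb hbil.
  by rewrite mul0n mulr0 expR0 mul1r; rewrite mul0n addn0 in hbil.
have -> : ep * (t.+1 * m0)%:R = ep * m0%:R + ep * (t * m0)%:R by rewrite mulSn natrD mulrDr.
rewrite expRD -mulrA.
have lk' : (0 < l <= k)%N by lia.
apply: (@bilinear_bound_step R p p_prime k n T X w f pos lam adm _ _ l a b m0 kp lk'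
  (@dec_lower l lk)) => //.
- by rewrite mulr_gt0 ?expR_gt0.
- lia.
- apply: leq_trans hb; rewrite leq_mul2l mulSn; apply/orP; right; lia.
- rewrite mulnDr mulSn; lia.
- apply: IH => //; rewrite -?addnA -?mulSn//; lia.
Qed.

(** Each round divides a scale by some l <= k and uses up one factor k!; the factor m0 keeps scale
    differences divisible into steps of length m0. *)
Definition scale_unit N := (k`! ^ N.+1 * m0)%N.

Lemma bilinear_bound_iterate0 N a b : (b <= n)%N ->
  bilinear 0 a b (2 * K * expR (h * n%:R - gain k h ep N 0 * b%:R)).
Proof.
move=> bn; rewrite gainN0.
have H := bilinear_bound0 p_prime adm (a := a) (@dec_k (n - b)%N) bn.
apply: bilinear_bound_le H => //.
rewrite natrB// mulrBr ler_wpM2r ?expR_ge0// mulr_natl mulr2n lerDl; exact: ltW.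
Qed.

(** The bound does not depend on a: it is proved at the largest admissible scale b (k - l + 1) / l
    by Hölder and carried down to a, at a cost of at most ep k b in the exponent. That scale is at
    most k b, whence the power of k in the condition on n. *)
Lemma bilinear_bound_iterate N l a b : (l < k)%N -> (scale_unit N %| b)%N -> (0 < b)%N ->
  (b * k ^ N.+1 <= n)%N -> (m0 %| a)%N -> (k * m0 <= a)%N -> (l * a <= b * (k - l).+1)%N ->
  bilinear l a b (2 * K * expR (h * n%:R - gain k h ep N l * b%:R)).
Proof.
elim: N l a b => [|N IH] l a b lk Qb b0 bn m0a ka la.
all: have k0 : (0 < k)%N by exact: leq_ltn_trans lk.
all: have kbn : (k * b <= n)%N
  by apply: leq_trans bn; rewrite mulnC leq_mul2l expnS leq_pmulr ?orbT// expn_gt0 k0.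
all: have bn' : (b <= n)%N by apply: leq_trans kbn; rewrite leq_pmull.
  case: l lk la => [|l] lk la; first exact: bilinear_bound_iterate0.
  have an : (a <= n)%N.
    by apply: leq_trans kbn; move: la lk; rewrite mulSn; nia.
  rewrite mul0r subr0.
  have H := bilinear_bound_base p_prime adm (ltnW lk) (@dec_k (n - a)%N) (@dec_k (n - b)%N) an bn'.
  apply: bilinear_bound_le H => //.
  have E c : K * expR (h * (n - c)%:R) <= K * expR (h * n%:R).
    by rewrite ler_wpM2l ?(ltW K_gt0)// ler_expR ler_wpM2l// ler_nat leq_subr.
  by apply: le_trans (lerD (E a) (E b)) _; rewrite -mulrA mulr_natl mulr2n.
case: l lk la => [|l] lk la; first exact: bilinear_bound_iterate0.
have lkf : (l.+1 %| k`!)%N by rewrite dvdn_fact//= ltnW.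
have kf0 := fact_gt0 k.
have /dvdnP[t bE] := Qb.
have t0 : (0 < t)%N by case: t bE b0 => // ->.
pose c := (t * (k`! %/ l.+1) * scale_unit N)%N.
have bc : b = (l.+1 * c)%N.
  rewrite bE /c /scale_unit !(expnS _ N.+1) -{1}(divnK lkf); ring.
have Qc : (scale_unit N %| c)%N by exact: dvdn_mull.
have m0Q N' : (m0 %| scale_unit N')%N by exact: dvdn_mull.
have kf : (k <= k`!)%N by apply: dvdn_leq => //; apply: dvdn_fact; rewrite k0/=.
have cc : (0 < t * (k`! %/ l.+1))%N by rewrite muln_gt0 t0 divn_gt0// dvdn_leq.
have ku : (k * m0 <= scale_unit N)%N.
  rewrite /scale_unit expnS leq_pmul2r//; apply: leq_trans kf _.
  by rewrite leq_pmulr// expn_gt0 kf0.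
have kc : (k * m0 <= c)%N by apply: leq_trans ku _; exact: leq_pmull.
clearbody c; clear cc ku kf bE.
have c0 : (0 < c)%N by apply: leq_trans kc; rewrite muln_gt0 k0.
pose m' := (k - l.+1)%N.
have m'k : (m' < k)%N by rewrite /m' ltn_subrL.
have m'0 : (0 < m')%N by rewrite subn_gt0.
pose a0 := (c * m'.+1)%N.
have a0k : (a0 <= k * b)%N.
  by rewrite /a0 bc mulnA (mulnC c) leq_mul2r (leq_trans m'k) ?orbT// leq_pmulr.
have Qa0 : (scale_unit N %| a0)%N by exact: dvdn_mulr.
have a0n : (a0 <= n)%N by exact: leq_trans kbn.
have m0a0 : (m0 %| a0)%N by apply: dvdn_trans Qa0.
have m0b : (m0 %| b)%N by apply: dvdn_trans Qb.
have Qb' : (scale_unit N %| b)%N by rewrite bc dvdn_mull.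
have kb : (k * m0 <= b)%N by rewrite bc (leq_trans kc)// leq_pmull.
have ka0 : (k * m0 <= a0)%N by rewrite (leq_trans kc)// leq_pmulr.
have a0pow : (a0 * k ^ N.+1 <= n)%N.
  by apply: leq_trans bn; rewrite (expnS k N.+1) mulnA leq_mul2r (mulnC b) a0k orbT.
have bpow : (b * k ^ N.+1 <= n)%N.
  by apply: leq_trans bn; rewrite leq_mul2l (expnS k N.+1) leq_pmull ?orbT.
have I1 := IH m' b a0 m'k Qa0 _ a0pow m0b kb _.
have {}I1 : bilinear m' b a0 (2 * K * expR (h * n%:R - gain k h ep N m' * a0%:R)).
  apply: I1; first by rewrite muln_gt0 c0.
  have -> : (k - m' = l.+1)%N by rewrite /m' subKn// ltnW.
  rewrite bc /a0 (_ : m' * (l.+1 * c) = c * (m' * l.+1))%N; last by ring.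
  by rewrite -mulnA leq_mul2l leq_mul ?orbT.
have I2 : bilinear l a0 b (2 * K * expR (h * n%:R - gain k h ep N l * b%:R)).
  apply: IH => //; first exact: ltnW.
  have -> : (k - l = m'.+1)%N by rewrite /m' subnSK// ltnW.
  rewrite bc /a0 (_ : l * (c * m'.+1) = c * (l * m'.+1))%N; last by ring.
  by rewrite (mulnC l.+1) -mulnA leq_mul2l leq_mul ?orbT.
have K20 : 0 < 2 * K by rewrite mulr_gt0.
have lk' : (0 < l.+1 <= k)%N by exact: ltnW.
(* The mean of the two savings with the Hölder weights 1 and m'. The first saving is per unit of
   [a0], because the exchanged form has [a0] as its second scale. *)
pose g := (gain k h ep N m' * a0%:R + m'%:R * (gain k h ep N l * b%:R)) / m'.+1%:R.
have I3 : bilinear l.+1 a0 b (2 * K * expR (h * n%:R - g)).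
  apply: bilinear_bound_holder I1 I2 => //; rewrite ?mulr_gt0 ?expR_gt0//.
  rewrite -/m' exprMn [RHS]exprMn mulrACA -exprS; congr (_ * _).
  rewrite -!expRM_natl -expRD; congr expR.
  by rewrite /g -natr1; field; rewrite natr1 pnatr_eq0.
have aa0 : (a <= a0)%N.
  by move: la; rewrite bc -/m' /a0 -mulnA leq_pmul2l.
have /dvdnP[s sE] : (m0 %| a0 - a)%N by exact: dvdn_sub.
have a0E : a0 = (a + s * m0)%N by rewrite -sE subnKC.
rewrite a0E in I3.
have := @bilinear_bound_descend _ l.+1 b s a _ _ _ _ _ bn' _ I3.
rewrite -a0E => H.
apply: (bilinear_bound_le adm _ (H _ _ _ _ _ _)) => //.
- rewrite mulrCA ler_wpM2l ?(ltW K20)// -expRD ler_expR /=.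
  have gE : g = (gain k h ep N m' / l.+1%:R + m'%:R / m'.+1%:R * gain k h ep N l) * b%:R.
    rewrite /g bc /a0 !natrM; field; rewrite ?pnatr_eq0//.
    by rewrite -!mulrS !pnatr_eq0.
  rewrite -/m' mulrBl -gE.
  have : ep * (s * m0)%:R <= ep * k%:R * b%:R.
    by rewrite -mulrA ler_wpM2l// -natrM ler_nat -sE (leq_trans (leq_subr _ _)).
  lra.
- by rewrite mulr_gt0// expR_gt0.
- by apply: leq_trans ka; rewrite muln_gt0 k0.
- by apply: leq_trans ka; rewrite leq_mul2r ltnW ?orbT.
- by rewrite /a0 bc -/m' mulnA.
Qed.
End Iteration.

(** * From bilinear to linear bounds *)

Section BroadNarrow.
Variable R : realType.

Lemma expr1D_le (u : R) q : 0 <= u <= 1 -> (1 + u) ^+ q <= 1 + 3 ^+ q * u.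
Proof.
move=> /andP[u0 u1]; elim: q => [|q IH]; first by rewrite !expr0 lerDl mul1r.
rewrite exprS; apply: (@le_trans _ _ ((1 + u) * (1 + 3 ^+ q * u))).
  by rewrite ler_wpM2l// addr_ge0.
have h : 1 <= 3 ^+ q :> R by rewrite exprn_ege1// ler1n.
rewrite exprS; set t := 3 ^+ q in h *.
have : t * u * u <= t * u by rewrite ler_piMr// mulr_ge0// (le_trans ler01).
have : u <= t * u by rewrite ler_peMl.
lra.
Qed.

(** The diagonal constant must be arbitrarily close to 1: the inequality is used once per scale, so
    the n-th power of this constant enters the final bound. *)
Lemma broad_narrow (I : finType) (q1 q2 : nat) (rho : R) : 1 < rho -> (0 < q2)%N ->
  exists2 C : R, 0 < C & forall z : I -> R[i],
    csq (\sum_i z i) ^+ (q1 + q2) <= rho * (\sum_i csq (z i) ^+ (q1 + q2)) +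
      C * \sum_i \sum_(j | j != i) csq (z i) ^+ q1 * csq (z j) ^+ q2.
Proof.
move=> rho1 q20; set q := (q1 + q2)%N.
have rho0 : 0 <= rho by rewrite ltW// (lt_trans ltr01).
have t0 : 0 < 3 ^+ q :> R by rewrite exprn_gt0.
(* One d is lost in [csqD], a second one to the off-diagonal part when it is small; hence (1 + 2
   d)^q <= rho. *)
pose d : R := Num.min 1 ((rho - 1) / 3 ^+ q) / 2.
have d0 : 0 < d by rewrite divr_gt0// lt_min ltr01 divr_gt0// subr_gt0.
have dq : (1 + 2 * d) ^+ q <= rho.
  have E : 2 * d = Num.min 1 ((rho - 1) / 3 ^+ q) by rewrite /d; field.
  apply: le_trans (expr1D_le _ _) _; first by rewrite E ge_min lexx/= -E mulr_ge0// ltW.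
  rewrite -lerBrDl mulrC -ler_pdivlMr// E ge_min lexx orbT//.
pose P : R := #|I|%:R.
pose C1 : R := (1 + d^-1) * (P ^+ 2 + 1).
have P0 : 0 <= P by exact: ler0n.
have C10 : 0 < C1.
  by apply: mulr_gt0; [rewrite ltr_pwDl// invr_ge0 ltW | rewrite ltr_wpDl// exprn_ge0].
pose C2 : R := (1 + d) / d * C1 + C1.
have C20 : 0 < C2 by rewrite addr_gt0// mulr_gt0// divr_gt0// addr_gt0.
exists (C2 ^+ q * (P + 1) ^+ q1 * (P + 1) ^+ q2).
  have P1 : 0 < P + 1 by rewrite ltr_wpDl// /P ler0n.
  by rewrite !mulr_gt0// exprn_gt0.
move=> z.
have S0 : 0 <= \sum_i csq (z i) ^+ q by rewrite sumr_ge0// => i _; rewrite exprn_ge0 ?csq_ge0.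
have S1 i : 0 <= \sum_(j | j != i) csq (z i) ^+ q1 * csq (z j) ^+ q2.
  by rewrite sumr_ge0// => j _; rewrite mulr_ge0// exprn_ge0 ?csq_ge0.
have q0 : (0 < q)%N by rewrite addn_gt0 q20 orbT.
case: (pickP (fun _ : I => true)) => [i0 _|I0]; last first.
  by rewrite !big_pred0 /csq//= expr0n/= addr0 expr0n/= (gtn_eqF q0) !mulr0 addr0.
have [i _ Hi] := Order.TotalTheory.arg_maxP (fun i => csq (z i)) (erefl (xpredT i0)).
set M := csq (z i) in Hi.
pose S := \sum_(j | j != i) csq (z j).
have M0 : 0 <= M by exact: csq_ge0.
have SS0 : 0 <= S by rewrite sumr_ge0// => j _; rewrite csq_ge0.
have cP : #|[pred j | j != i]|%:R <= P by rewrite ler_nat max_card.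
have SM : S <= (P + 1) * M.
  apply: (@le_trans _ _ (\sum_(j | j != i) M)); first by apply: ler_sum => j _; exact: Hi.
  rewrite sumr_const -mulr_natl ler_wpM2r//; apply: le_trans cP _; rewrite lerDl//.
have FM : csq (\sum_i z i) <= (1 + d) * M + C1 * S.
  rewrite (bigD1 i)//=; apply: le_trans (csqD _ _ d0) _.
  rewrite lerD2l /C1 -mulrA ler_wpM2l ?addr_ge0 ?invr_ge0 ?(ltW d0)//.
  apply: le_trans (csq_sum_le _ _) _; rewrite ler_wpM2r//.
  apply: (@le_trans _ _ (P ^+ 2)); last by rewrite lerDl.
  by rewrite lerXn2r ?nnegrE ?ler0n.
(* Either [z i] dominates all the others, or they are comparable to it. *)
case: (leP (C1 * S) (d * M)) => [small|large].
  apply: (@le_trans _ _ (rho * M ^+ q)); last first.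
    rewrite -[leLHS]addr0 lerD//.
      rewrite ler_wpM2l//.
      by rewrite (bigD1 i)//= lerDl sumr_ge0// => j _; rewrite exprn_ge0 ?csq_ge0.
    rewrite mulr_ge0 ?mulr_ge0 ?exprn_ge0 ?(ltW C20) ?addr_ge0 ?ler0n//.
    by rewrite sumr_ge0.
  apply: (@le_trans _ _ (((1 + 2 * d) * M) ^+ q)).
    have D0 : 0 <= (1 + 2 * d) * M by rewrite mulr_ge0// addr_ge0// mulr_ge0// ltW.
    rewrite lerXn2r ?nnegrE ?csq_ge0//.
    by apply: le_trans FM _; move: small; lra.
  by rewrite exprMn ler_wpM2r// exprn_ge0.
have F2 : csq (\sum_i z i) <= C2 * S.
  apply: le_trans FM _; rewrite /C2 [leRHS]mulrDl lerD2r.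
  rewrite (_ : _ * C1 * S = (1 + d) * (d^-1 * (C1 * S))); last by rewrite !mulrA.
  rewrite ler_wpM2l ?addr_ge0 ?(ltW d0)//.
  by rewrite ler_pdivlMl// ltW.
apply: (@le_trans _ _ ((C2 ^+ q * (P + 1) ^+ q1 * (P + 1) ^+ q2) *
    \sum_(j | j != i) csq (z i) ^+ q1 * csq (z j) ^+ q2)); last first.
  rewrite -[leLHS]add0r lerD//.
    exact: mulr_ge0.
  rewrite ler_wpM2l ?mulr_ge0 ?exprn_ge0 ?(ltW C20) ?addr_ge0 ?ler0n//.
  by rewrite [leRHS](bigD1 i)//= lerDl sumr_ge0.
apply: (@le_trans _ _ ((C2 * S) ^+ q)).
  by rewrite lerXn2r ?nnegrE ?csq_ge0// mulr_ge0// ltW.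
rewrite exprMn -!mulrA ler_wpM2l ?exprn_ge0 ?(ltW C20)// /q exprD.
rewrite -mulr_sumr -/M; set W := \sum_(_ | _) _.
rewrite (_ : _ * (_ * (_ * W)) = ((P + 1) * M) ^+ q1 * ((P + 1) ^+ q2 * W)); last first.
  by rewrite exprMn; ring.
apply: ler_pM; rewrite ?exprn_ge0//.
  by rewrite lerXn2r ?nnegrE// (le_trans SS0).
rewrite /W -(prednK q20); apply: le_trans (expr_sum_le _ _) _; first by move=> j _; rewrite csq_ge0.
rewrite ler_wpM2r//; first by rewrite sumr_ge0// => j _; rewrite exprn_ge0 ?csq_ge0.
by rewrite lerXn2r ?nnegrE ?addr_ge0 ?ler0n//; apply: le_trans cP _; rewrite lerDl.
Qed.

End BroadNarrow.

Section Assembly.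
Variables (R : realType) (p : nat).
Hypothesis p_prime : prime p.
Let p_gt0 : (0 < p)%N := prime_gt0 p_prime.

(** The exponent 3 q is 2 q from the squared modulus of the sum plus q from the power of the sum of
    squared moduli; only its being linear in d matters. *)
Lemma piece_refine_expr (T X : finType) (f : X -> T -> R[i]) pos a d xi g q :
  (xi < p ^ a)%N -> (0 < q)%N ->
  csq (piece p f pos a xi g) ^+ q <= (p ^ d)%:R ^+ (3 * q) *
    \sum_(v < (p ^ d)%N) csq (piece p f pos (a + d)%N (xi + p ^ a * v)%N g) ^+ q.
Proof.
move=> hxi q0; rewrite (piece_refine p_prime f pos d g hxi).
set z := fun v : 'I_(p ^ d) => piece p f pos (a + d)%N (xi + p ^ a * v)%N g.
have P0 : 0 <= (p ^ d)%:R :> R by exact: ler0n.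
apply: (@le_trans _ _ (((p ^ d)%:R ^+ 2 * \sum_v csq (z v)) ^+ q)).
  rewrite lerXn2r ?nnegrE ?csq_ge0//.
    by rewrite mulr_ge0 ?exprn_ge0// sumr_ge0// => v _; rewrite csq_ge0.
  by apply: le_trans (csq_sum_le _ _) _; rewrite card_ord.
rewrite exprMn (_ : (3 * q = 2 * q + q)%N); last by ring.
rewrite exprD -mulrA -exprM ler_wpM2l ?exprn_ge0//.
rewrite -(prednK q0); apply: le_trans (expr_sum_le _ _) _; last by rewrite card_ord.
by move=> v _; rewrite csq_ge0.
Qed.

Lemma mass_refine_expr n (lam : nat -> R) a d xi q : (forall z, (z < p ^ n)%N -> 0 < lam z) ->
  (xi < p ^ a)%N -> (0 < q)%N ->
  \sum_(v < (p ^ d)%N) mass p n lam (a + d)%N (xi + p ^ a * v)%N ^+ q <= mass p n lam a xi ^+ q.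
Proof.
move=> hl hxi q0; rewrite (mass_refine p_prime n lam d hxi) -(prednK q0).
by apply: sum_expr_le => v _; exact: mass_ge0.
Qed.

Lemma decoupling_trivial k n : (0 < k)%N -> decoupling p k n ((p ^ n)%:R ^+ (3 * crit k) : R).
Proof.
move=> k0 T X w f pos lam [hw ho hl hm].
have q0 := crit_gt0 k0.
have P0 : 0 <= (p ^ n)%:R ^+ (3 * crit k) :> R by rewrite exprn_ge0 ?ler0n.
have h0 : (0 < p ^ 0)%N by [].
apply: (@le_trans _ _ (\sum_g w g * ((p ^ n)%:R ^+ (3 * crit k) *
    \sum_(v < (p ^ n)%N) csq (piece p f pos n v g) ^+ crit k))).
  apply: ler_sum => g _; rewrite ler_wpM2l//.
  apply: le_trans (piece_refine_expr f pos n g h0 q0) _; rewrite ler_wpM2l//.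
  by apply: ler_sum => v _; rewrite add0n add0n expn0 mul1n.
under eq_bigr do rewrite mulrCA mulr_sumr.
rewrite -mulr_sumr ler_wpM2l// exchange_big /=.
apply: le_trans (mass_refine_expr n hl h0 q0).
by apply: ler_sum => v _; rewrite add0n add0n expn0 mul1n mass_full// hm.
Qed.

Section Context.
Variables (k n : nat) (T X : finType) (w : T -> R) (f : X -> T -> R[i]) (pos : X -> nat).
Variable lam : nat -> R.
Hypothesis adm : admissible p k n w f pos lam.

(** The loss is exponential in a + b, so the saving per unit of b must exceed a fixed constant; this
    is why many rounds are needed. *)
Lemma bilinear_bound_coarsen A l a b : (0 < l < k)%N -> 0 <= A ->
  bilinear_bound p k n w f pos lam l (1 + a)%N (1 + b)%N A ->
  bilinear_bound p k n w f pos lam l 1 1 ((p ^ (a + b))%:R ^+ (3 * crit k) * A).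
Proof.
move=> /andP[l0 lk] A0 h xi eta hxi heta ne.
case: adm => hw _ hl _.
have ql0 := crit_gt0 l0.
have qlk : (crit l < crit k)%N.
  by apply: leq_trans (leq_crit lk); rewrite critS addnS ltnS leq_addr.
have q'0 : (0 < crit k - crit l)%N by rewrite subn_gt0.
set ql := crit l in ql0 qlk q'0 *; set q' := (crit k - ql)%N in q'0 *.
have qE : crit k = (ql + q')%N by rewrite subnKC// ltnW.
set Pa := (p ^ a)%:R ^+ (3 * ql) : R; set Pb := (p ^ b)%:R ^+ (3 * q') : R.
have Pa0 : 0 <= Pa by rewrite exprn_ge0 ?ler0n.
have Pb0 : 0 <= Pb by rewrite exprn_ge0 ?ler0n.
have PE : Pa * Pb <= (p ^ (a + b))%:R ^+ (3 * crit k).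
  rewrite qE mulnDr exprD; apply: ler_pM => //; rewrite lerXn2r ?nnegrE ?ler0n// ler_nat leq_pexp2l//.
    exact: leq_addr.
  exact: leq_addl.
set x := fun (v : 'I_(p ^ a)) g => csq (piece p f pos (1 + a)%N (xi + p ^ 1 * v)%N g) ^+ ql.
set y := fun (v : 'I_(p ^ b)) g => csq (piece p f pos (1 + b)%N (eta + p ^ 1 * v)%N g) ^+ q'.
apply: (@le_trans _ _ (\sum_g w g * ((Pa * \sum_v x v g) * (Pb * \sum_v y v g)))).
  apply: ler_sum => g _; rewrite ler_wpM2l//; apply: ler_pM; rewrite ?exprn_ge0 ?csq_ge0//.
    exact: piece_refine_expr.
  exact: piece_refine_expr.
have -> : \sum_g w g * ((Pa * \sum_v x v g) * (Pb * \sum_v y v g)) =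
    Pa * Pb * \sum_v \sum_u \sum_g w g * (x v g * y u g).
  have E g : w g * ((Pa * \sum_v x v g) * (Pb * \sum_v y v g)) =
      Pa * Pb * \sum_v \sum_u w g * (x v g * y u g).
    rewrite (_ : _ * _ = Pa * Pb * (w g * ((\sum_v x v g) * \sum_v y v g))); last by ring.
    congr (_ * _); rewrite mulr_suml mulr_sumr; apply: eq_bigr => v _.
    by rewrite !mulr_sumr.
  under eq_bigr do rewrite E.
  rewrite -mulr_sumr; congr (_ * _); rewrite exchange_big; apply: eq_bigr => v _.
  by rewrite exchange_big.
set La := fun v : 'I_(p ^ a) => mass p n lam (1 + a)%N (xi + p ^ 1 * v)%N ^+ ql.
set Lb := fun v : 'I_(p ^ b) => mass p n lam (1 + b)%N (eta + p ^ 1 * v)%N ^+ q'.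
apply: (@le_trans _ _ (Pa * Pb * \sum_v \sum_u A * (La v * Lb u))).
  rewrite ler_wpM2l ?mulr_ge0//; apply: ler_sum => v _; apply: ler_sum => u _.
  apply: h; rewrite ?addn_mulpow_lt//.
  by rewrite expn1 !(addnC _ (p * _)%N) !(mulnC p) !modnMDl.
have -> : \sum_v \sum_u A * (La v * Lb u) = A * ((\sum_v La v) * \sum_u Lb u).
  rewrite mulr_suml mulr_sumr; apply: eq_bigr => v _.
  by rewrite !mulr_sumr.
rewrite -[leRHS]mulrA; apply: ler_pM; rewrite ?mulr_ge0 ?sumr_ge0//.
- by move=> v _; rewrite exprn_ge0// mass_ge0.
- by move=> v _; rewrite exprn_ge0// mass_ge0.
rewrite ler_wpM2l//; apply: ler_pM; rewrite ?sumr_ge0//.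
- by move=> v _; rewrite exprn_ge0// mass_ge0.
- by move=> v _; rewrite exprn_ge0// mass_ge0.
- exact: mass_refine_expr.
- exact: mass_refine_expr.
Qed.

End Context.

(** The classes mod p give the pieces. A single class is dilated and has n - 1 scales left; two
    different classes are distinct mod p, as the bilinear bound requires. *)
Lemma decoupling_broad_narrow k l (rho : R) : 1 < rho -> (0 < l < k)%N ->
  exists2 C : R, 0 < C & forall n D A, (0 < n)%N -> 0 <= D -> 0 <= A -> decoupling p k n.-1 D ->
    (forall (T X : finType) (w : T -> R) (f : X -> T -> R[i]) (pos : X -> nat) (lam : nat -> R),
      admissible p k n w f pos lam -> bilinear_bound p k n w f pos lam l 1 1 A) ->
    decoupling p k n (rho * D + C * A).
Proof.
move=> rho1 /andP[l0 lk].
have ql0 := crit_gt0 l0.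
have qlk : (crit l < crit k)%N.
  by apply: leq_trans (leq_crit lk); rewrite critS addnS ltnS leq_addr.
have q'0 : (0 < crit k - crit l)%N by rewrite subn_gt0.
have qE : (crit l + (crit k - crit l) = crit k)%N by rewrite subnKC// ltnW.
have q0 : (0 < crit k)%N by apply: leq_trans qlk.
have rho0 : 0 <= rho by rewrite ltW// (lt_trans ltr01).
have [C C0 HC] := @broad_narrow R 'I_(p ^ 1) (crit l) (crit k - crit l) rho rho1 q'0.
exists (C * p%:R ^+ 2); first by rewrite mulr_gt0// exprn_gt0// ltr0n.
move=> n D A n0 D0 A0 dec bil T X w f pos lam adm.
have {}bil := bil _ _ _ _ _ _ adm.

case: (adm) => hw _ hl _.
rewrite qE in HC.
have h0 : (0 < p ^ 0)%N by [].
pose z g (v : 'I_(p ^ 1)) := piece p f pos 1 v g.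
pose L (v : 'I_(p ^ 1)) := mass p n lam 1 v.
have zE g : piece p f pos 0 0 g = \sum_v z g v.
  rewrite (piece_refine p_prime f pos 1 g h0); apply: eq_bigr => v _.
  by rewrite add0n add0n expn0 mul1n.
have LE : mass p n lam 0 0 = \sum_v L v.
  rewrite (mass_refine p_prime n lam 1 h0); apply: eq_bigr => v _.
  by rewrite add0n add0n expn0 mul1n.
have L0 v : 0 <= L v by exact: mass_ge0.
have LL v : L v <= \sum_v L v by rewrite [leRHS](bigD1 v)//= lerDl sumr_ge0.
rewrite LE; set Lam := \sum_v L v in LL *.
have Lam0 : 0 <= Lam by rewrite sumr_ge0.
apply: (@le_trans _ _ (\sum_g w g * (rho * (\sum_i csq (z g i) ^+ crit k) +
      C * \sum_i \sum_(j | j != i) csq (z g i) ^+ crit l * csq (z g j) ^+ (crit k - crit l)))).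
  by apply: ler_sum => g _; rewrite ler_wpM2l// zE.
have -> : \sum_g w g * (rho * (\sum_i csq (z g i) ^+ crit k) +
      C * \sum_i \sum_(j | j != i) csq (z g i) ^+ crit l * csq (z g j) ^+ (crit k - crit l)) =
   rho * (\sum_i \sum_g w g * csq (z g i) ^+ crit k) +
   C * \sum_i \sum_(j | j != i) \sum_g w g * (csq (z g i) ^+ crit l * csq (z g j) ^+ (crit k - crit l)).
  have E (G1 G2 : T -> R) : \sum_g w g * (rho * G1 g + C * G2 g) =
      rho * (\sum_g w g * G1 g) + C * \sum_g w g * G2 g.
    by rewrite !mulr_sumr -big_split; apply: eq_bigr => g _ /=; ring.
  rewrite E; congr (_ * _ + _ * _).
    by under eq_bigr do rewrite mulr_sumr; rewrite exchange_big.
  under eq_bigr do rewrite mulr_sumr; rewrite exchange_big; apply: eq_bigr => i _.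
  by under eq_bigr do rewrite mulr_sumr; rewrite exchange_big.
rewrite mulrDl; apply: lerD; rewrite -mulrA ?ler_wpM2l//.
  apply: (@le_trans _ _ (\sum_i D * L i ^+ crit k)).
    apply: ler_sum => i _; apply: (piece_moment p_prime adm) => //.
      by rewrite subn1.
  rewrite -mulr_sumr ler_wpM2l// -(prednK q0); exact: sum_expr_le.
rewrite -!mulrA ler_wpM2l ?(ltW C0)//.
apply: (@le_trans _ _ (\sum_(i < (p ^ 1)%N) \sum_(j < (p ^ 1)%N) A * Lam ^+ crit k)).
  apply: ler_sum => i _; rewrite big_mkcond; apply: ler_sum => j _.
  case: ifPn => ji; last by rewrite mulr_ge0// exprn_ge0.
  apply: le_trans (bil i j _ _ _) _ => //.
    by apply: contra ji => /eqP; rewrite !modn_small -?[p]expn1// => e; apply/eqP/val_inj.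
  have -> : Lam ^+ crit k = Lam ^+ crit l * Lam ^+ (crit k - crit l) by rewrite -exprD qE.
  have Le i' m : L i' ^+ m <= Lam ^+ m by rewrite lerXn2r ?nnegrE.
  by rewrite ler_wpM2l// ler_pM ?exprn_ge0 ?L0 ?Le//; exact: L0.
by rewrite !sumr_const !card_ord expn1 -mulrnA -[leLHS]mulr_natl natrM -mulrA.
Qed.

End Assembly.

(** * Lowering the exponent, and induction on the degree *)

Section Main.
Variables (R : realType) (p : nat).
Hypothesis p_prime : prime p.
Let p_gt0 : (0 < p)%N := prime_gt0 p_prime.

Lemma decoupling_le k n (D D' : R) : D <= D' -> decoupling p k n D -> decoupling p k n D'.
Proof.
move=> DD h T X w f pos lam adm; apply: le_trans (h _ _ _ _ _ _ adm) _.
by rewrite ler_wpM2r// exprn_ge0// mass_ge0//; case: adm.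
Qed.

(** The exponent counts per scale in natural units: h = theta ln p stands for a bound
    (p^n)^theta. *)
Definition decoupling_exp k (h : R) :=
  exists2 K : R, 0 < K & forall n, decoupling p k n (K * expR (h * n%:R)).

Lemma decoupling_exp_le k h h' : h <= h' -> decoupling_exp k h -> decoupling_exp k h'.
Proof.
move=> hh [K K0 HK]; exists K => // n; apply: decoupling_le (HK n).
by rewrite ler_wpM2l ?(ltW K0)// ler_expR ler_wpM2r.
Qed.

Definition trivial_rate k : R := (3 * crit k)%:R * ln p%:R.

Lemma trivial_rate_ge0 k : 0 <= trivial_rate k.
Proof. by rewrite mulr_ge0 ?ler0n// ln_ge0// ler1n. Qed.

Lemma trivial_rateE k m : (p ^ m)%:R ^+ (3 * crit k) = expR (trivial_rate k * m%:R).
Proof.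
rewrite /trivial_rate -mulrA expRM_natl (mulrC (ln _)) expRM_natl lnK ?natrX//.
by rewrite posrE ltr0n.
Qed.

(** The decrement depends on e0 but not on h, so finitely many improvements bring any exponent down
    to e0. *)
Lemma decoupling_exp_improve k (e0 : R) : (1 < k < p)%N -> 0 < e0 ->
  (forall ep : R, 0 < ep -> exists2 m : nat, (0 < m)%N &
    forall l, (0 < l < k)%N -> decoupling p l m (expR (ep * m%:R))) ->
  exists2 kap : R, 0 < kap & forall h, e0 <= h -> decoupling_exp k h -> decoupling_exp k (h - kap).
Proof.
move=> /andP[k1 kp] e00 lower.
have k0 : (0 < k)%N by exact: ltnW.
have kR : 0 < k%:R :> R by rewrite ltr0n.
(* The loss ep k per round is half of e0 / k, the least value of h / k; the other half remains as
   [e1]. *)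
pose ep := e0 / (2 * k%:R ^+ 2).
have ep0 : 0 < ep by rewrite divr_gt0// mulr_gt0// exprn_gt0.
have [m0 m00 dec_lower] := lower _ ep0.
pose e1 := e0 / (2 * k%:R).
have e10 : 0 < e1 by rewrite divr_gt0// mulr_gt0.
have e1h h : e0 <= h -> e1 <= h / k%:R - ep * k%:R.
  move=> eh; apply: (@le_trans _ _ (e0 / k%:R - ep * k%:R)).
    by rewrite /e1 /ep le_eqVlt; apply/orP; left; apply/eqP; field; rewrite gt_eqF.
  by rewrite lerD2r ler_pM2r ?invr_gt0.
pose q3 := trivial_rate k; have q30 : 0 <= q3 by exact: trivial_rate_ge0.
(* Returning to scale 1 costs at most 2 q3 b in the exponent; the 1 leaves a net saving of b. *)
pose G := 2 * q3 + 1.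
have G0 : 0 <= G by rewrite addr_ge0// mulr_ge0.
pose N := Num.bound (G / e1).
have GN : G <= N%:R * e1.
  by rewrite -ler_pdivrMr// ltW// archi_boundP// divr_ge0// ltW.
pose U := scale_unit k m0 N; pose B := (k ^ N.+1)%N; pose n1 := (U * B)%N.
have B0 : (0 < B)%N by rewrite expn_gt0 k0.
have U0 : (0 < U)%N by rewrite muln_gt0 expn_gt0 fact_gt0.
have n10 : (0 < n1)%N by rewrite muln_gt0 U0.
have km0 : (k.-1 * (k * m0) <= U)%N.
  rewrite /U /scale_unit mulnA leq_pmul2r// expnS -[X in (X <= _)%N]muln1.
  apply: leq_mul; last by rewrite expn_gt0 fact_gt0.
  rewrite mulnC -(prednK k0) /= factS leq_mul2l dvdn_leq ?fact_gt0//.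
  by apply: dvdn_fact; rewrite leqnn andbT -ltnS prednK.
(* The first term gives kap n <= b, as n <= 2 b B below; the second keeps the new exponent at least
   e0 / 2. *)
pose kap : R := Num.min (1 / (2 * B%:R)) (e0 / 2).
have kap0 : 0 < kap by rewrite lt_min !divr_gt0// mulr_gt0// ltr0n.
exists kap => // h eh [K K0 HK].
have h0 : 0 <= h by apply: le_trans eh; exact: ltW.
have hk : e0 / 2 <= h - kap.
  have : kap <= e0 / 2 by rewrite ge_min lexx orbT.
  lra.
have hk0 : 0 <= h - kap by apply: le_trans hk; rewrite divr_ge0// ltW.
have [l lk gl] := gain_unbounded k1 e10 (e1h h eh) GN.
have rho1 : 1 < expR (e0 / 4) :> R by rewrite expR_gt1 divr_gt0.
have [C C0 HC] := decoupling_broad_narrow p_prime rho1 lk.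
pose th : R := 1 - expR (- (e0 / 4)).
have th0 : 0 < th by rewrite subr_gt0 expR_lt1 oppr_lt0 divr_gt0.
(* The first summand covers n < n1 by the trivial bound. The second fits the broad term into the
   share [th], since the narrow term takes at most 1 - th. *)
pose K' := expR (q3 * n1%:R) + 2 * C * K / th.
have KK0 : 0 < 2 * C * K / th by rewrite divr_gt0// !mulr_gt0.
have K'0 : 0 < K' by rewrite addr_gt0// expR_gt0.
exists K' => //.
have bil n : (n1 <= n)%N ->
    forall (T X : finType) (w : T -> R) (f : X -> T -> R[i]) (pos : X -> nat) (lam : nat -> R),
      admissible p k n w f pos lam ->
      bilinear_bound p k n w f pos lam l 1 1 (2 * K * expR ((h - kap) * n%:R)).
  move=> nn T X w f pos lam adm.
  (* The largest multiple of [U] with b B <= n, hence comparable to n. *)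
  pose b := (U * (n %/ n1))%N.
  (* The smallest scale that the iteration admits for the first class. *)
  pose a := (k * m0)%N.
  have t0 : (0 < n %/ n1)%N by rewrite divn_gt0.
  have bB : (b * B = (n %/ n1) * n1)%N by rewrite /b /n1; ring.
  have b0 : (0 < b)%N by rewrite muln_gt0 U0.
  have bBn : (b * B <= n)%N by rewrite bB leq_trunc_div.
  have nb : (n <= 2 * (b * B))%N.
    rewrite bB; apply/ltnW/(leq_trans (ltn_ceil n n10)).
    by rewrite mulSn mul2n -addnn leq_add2r leq_pmull.
  have a0 : (0 < a)%N by rewrite muln_gt0 k0.
  have l0 : (0 < l)%N by case/andP: lk.
  have lk1 : (l < k)%N by case/andP: lk.
  have Ub : (U <= b)%N by rewrite leq_pmulr.
  have ab : (a <= b)%N.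
    by apply: leq_trans Ub; apply: leq_trans km0; rewrite leq_pmull// -ltnS prednK.
  have la : (l * a <= b * (k - l).+1)%N.
    apply: (@leq_trans b); last by rewrite leq_pmulr.
    apply: leq_trans Ub; apply: leq_trans km0; rewrite leq_mul2r -ltnS prednK// lk1 orbT//.
  have I := @bilinear_bound_iterate R p p_prime k n T X w f pos lam adm kp h ep K m0
    m00 h0 (ltW ep0) K0 HK dec_lower N l a b
    lk1 (dvdn_mulr _ (dvdnn _)) b0 bBn (dvdn_mull _ (dvdnn _)) (leqnn _) la.
  have {}I : bilinear_bound p k n w f pos lam l (1 + a.-1)%N (1 + b.-1)%N
      (2 * K * expR (h * n%:R - gain k h ep N l * b%:R)).
    by rewrite !add1n !prednK.
  have A0 : 0 <= 2 * K * expR (h * n%:R - gain k h ep N l * b%:R).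
    by rewrite !mulr_ge0 ?expR_ge0// ltW.
  have := bilinear_bound_coarsen p_prime adm lk A0 I.
  apply: bilinear_bound_le => //.
  rewrite trivial_rateE mulrCA ler_wpM2l ?mulr_ge0 ?(ltW K0)// -expRD ler_expR.
  have h1 : q3 * (a.-1 + b.-1)%:R <= q3 * (2 * b%:R).
    rewrite ler_wpM2l// -(natrM _ 2) ler_nat mul2n -addnn leq_add ?leq_pred//.
    by apply: leq_trans ab; exact: leq_pred.
  have h2 : G * b%:R <= gain k h ep N l * b%:R by rewrite ler_wpM2r.
  have h3 : kap * n%:R <= b%:R.
    apply: (@le_trans _ _ (1 / (2 * B%:R) * n%:R)).
      by rewrite ler_wpM2r// ge_min lexx.
    rewrite mul1r ler_pdivrMl ?mulr_gt0 ?ltr0n//.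
    by rewrite -(natrM _ 2) -natrM ler_nat; apply: leq_trans nb _; rewrite -mulnA (mulnC B).
  rewrite mulrBl; move: h1 h2 h3; rewrite /G mulrDl mul1r -/q3; lra.
elim=> [|n IH].
  have H := @decoupling_trivial R p p_prime k 0 k0; apply: decoupling_le H.
  rewrite mulr0 expR0 mulr1 expn0 expr1n /K' -[leLHS]addr0 lerD ?(ltW KK0)//.
  by rewrite -expR0 ler_expR mulr_ge0.
case: (leqP n1 n.+1) => [nn|nn]; last first.
  have H := @decoupling_trivial R p p_prime k n.+1 k0; apply: decoupling_le H.
  rewrite trivial_rateE; apply: (@le_trans _ _ (K' * 1)).
    rewrite mulr1 /K' -[leLHS]addr0 lerD ?(ltW KK0)//.
    by rewrite ler_expR ler_wpM2l// ler_nat ltnW.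
  by rewrite ler_wpM2l ?(ltW K'0)// -expR0 ler_expR mulr_ge0.
apply: decoupling_le (HC n.+1 _ _ isT _ _ IH (bil _ nn)); last first.
- by rewrite !mulr_ge0 ?expR_ge0// ltW.
- by rewrite mulr_ge0 ?expR_ge0// ltW.
set E := expR ((h - kap) * n.+1%:R).
have E0 : 0 <= E by exact: expR_ge0.
have h1 : expR (e0 / 4) * (K' * expR ((h - kap) * n%:R)) <= K' * ((1 - th) * E).
  rewrite mulrCA ler_wpM2l ?(ltW K'0)// /th subKr /E -!expRD ler_expR -(addn1 n) natrD mulrDr.
  move: hk; lra.
have h2 : C * (2 * K * E) <= K' * (th * E).
  rewrite (_ : C * _ = (2 * C * K) * E); last by ring.
  rewrite mulrA ler_wpM2r// -ler_pdivrMr// /K' lerDr expR_ge0//.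
apply: le_trans (lerD h1 h2) _.
by rewrite le_eqVlt; apply/orP; left; apply/eqP; ring.
Qed.

End Main.

Section Induction.
Variables (R : realType) (p : nat).
Hypothesis p_prime : prime p.

(** As [crit 1] is 1, this is a second moment: positions in distinct classes mod p^n violate the
    linear congruence, so all cross terms vanish. *)
Lemma decoupling1 n : decoupling p 1 n (1 : R).
Proof.
move=> T X w f pos lam [hw ho hl hm].
rewrite mul1r mul1n in ho *.
have crit1 : crit 1 = 1%N by [].
rewrite crit1 expr1 in hm *.
under eq_bigr do rewrite expr1.
have h0 : (0 < p ^ 0)%N by [].
pose z g (v : 'I_(p ^ n)) := piece p f pos n v g.
have zE g : piece p f pos 0 0 g = \sum_v z g v.
  rewrite (piece_refine p_prime f pos n g h0); apply: eq_bigr => v _.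
  by rewrite add0n add0n expn0 mul1n.
have E : \sum_g w g * csq (piece p f pos 0 0 g) = \sum_v \sum_g w g * csq (z g v).
  apply: complexI; rewrite !rmorph_sum /=.
  have E1 g : (w g * csq (piece p f pos 0 0 g))%:C%C =
      \sum_v \sum_u (w g)%:C%C * z g v * (z g u)^*%C.
    have G (c : R[i]) (y : 'I_(p ^ n) -> R[i]) :
        c * ((\sum_v y v) * \sum_v (y v)^*%C) = \sum_v \sum_u c * y v * (y u)^*%C.
      rewrite mulr_suml mulr_sumr; apply: eq_bigr => v _.
      by rewrite !mulr_sumr; apply: eq_bigr => u _; rewrite mulrA.
    by rewrite rmorphM /= csqE zE rmorph_sum /= G.
  under eq_bigr do rewrite E1.
  rewrite exchange_big /=; apply: eq_bigr => v _.
  rewrite exchange_big (bigD1 v)//= [X in _ + X]big1 ?addr0.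
    by rewrite rmorph_sum; apply: eq_bigr => g _; rewrite rmorphM /= csqE mulrA.
  move=> u uv; rewrite /z /piece.
  under eq_bigr do rewrite rmorph_sum mulr_sumr.
  rewrite exchange_big big1// => y /eqP yu.
  under eq_bigr do rewrite mulr_sumr mulr_suml.
  rewrite exchange_big big1// => x /eqP xv.
  apply/eqP/negPn/negP => ne.
  have := ho [:: x] [:: y] erefl.
  under eq_bigr do rewrite !big_seq1.
  move=> /(_ ne 1%N isT); rewrite !big_seq1 !expn1 xv yu => vu.
  by move: uv; rewrite -val_eqE /= vu eqxx.
rewrite E mass00; apply: ler_sum => v _.
by have := hm v (ltn_ord v); under eq_bigr do rewrite expr1.
Qed.

Lemma decoupling_exp1 (h : R) : 0 < h -> decoupling_exp p 1 h.
Proof.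
move=> h0; exists 1 => // n; rewrite mul1r.
have H : 1 <= expR (h * n%:R) by rewrite -expR0 ler_expR mulr_ge0 ?(ltW h0).
exact (decoupling_le H (@decoupling1 n)).
Qed.

Lemma decoupling_exp_of_lower k (e0 : R) : (1 < k < p)%N -> 0 < e0 ->
  (forall ep : R, 0 < ep -> exists2 m : nat, (0 < m)%N &
    forall l, (0 < l < k)%N -> decoupling p l m (expR (ep * m%:R))) ->
  decoupling_exp p k e0.
Proof.
move=> kp e00 lower.
have [kap kap0 H] := decoupling_exp_improve p_prime kp e00 lower.
pose h0 : R := trivial_rate R p k.
have It i : decoupling_exp p k (Num.max (h0 - i%:R * kap) e0).
  elim: i => [|i IH].
    apply: (@decoupling_exp_le R p k h0); first by rewrite mul0r subr0 le_max lexx.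
    exists 1 => // n; rewrite mul1r -trivial_rateE//.
    by apply: decoupling_trivial => //; case/andP: kp => /ltnW.
  have := H _ _ IH; rewrite le_max lexx orbT => /(_ isT).
  apply: decoupling_exp_le; rewrite lerBlDr ge_max -natr1 mulrDl mul1r; apply/andP; split.
    by rewrite -lerBlDr le_max; apply/orP; left; rewrite opprD addrA.
  by rewrite -lerBlDr le_max; apply/orP; right; rewrite gerBl ltW.
pose i := Num.bound (h0 / kap).
apply: (decoupling_exp_le _ (It i)); rewrite ge_max lexx andbT.
have : h0 / kap < i%:R by apply: archi_boundP; rewrite divr_ge0 ?trivial_rate_ge0 ?(ltW kap0).
by rewrite ltr_pdivrMr// => /ltW hi; rewrite lerBlDr (le_trans hi)// lerDr ltW.
Qed.

(** With exponent ep / 2, the constant K is absorbed by exp (ep m / 2) once m is large; a maximum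
    over the finitely many degrees gives one threshold. *)
Lemma common_scale k : (forall l, (0 < l < k)%N -> forall e : R, 0 < e -> decoupling_exp p l e) ->
  forall ep : R, 0 < ep -> exists M : nat, forall m, (M <= m)%N -> forall l, (0 < l < k)%N ->
    decoupling p l m (expR (ep * m%:R)).
Proof.
elim: k => [|k IH] h ep ep0; first by exists 0%N => m _ l; rewrite ltn0 andbF.
have [M HM] : exists M : nat, forall m, (M <= m)%N -> forall l, (0 < l < k)%N ->
    decoupling p l m (expR (ep * m%:R)).
  by apply: IH => // l /andP[l0 lk]; apply: h; rewrite l0 ltnW.
case: (posnP k) => [k0|k0].
  by exists 0%N => m _ l; rewrite k0 ltnS leqn0 => /andP[+ /eqP l0]; rewrite l0.
have ep20 : 0 < ep / 2 by rewrite divr_gt0.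
have [K K0 HK] : decoupling_exp p k (ep / 2) by apply: h; rewrite ?k0 ?leqnn.
exists (maxn M (Num.bound (K / (ep / 2)))) => m; rewrite geq_max => /andP[Mm Km] l.
rewrite ltnS [(l <= _)%N]leq_eqVlt => /andP[l0 /orP[/eqP ->|lk]]; last by apply: HM; rewrite ?l0.
apply: (decoupling_le _ (HK m)) => //.
have -> : ep * m%:R = ep / 2 * m%:R + ep / 2 * m%:R by field.
rewrite expRD ler_wpM2r ?expR_ge0//.
have h1 : K <= ep / 2 * m%:R.
  rewrite mulrC -ler_pdivrMr//.
  apply: (@le_trans _ _ (Num.bound (K / (ep / 2)))%:R); last by rewrite ler_nat.
  by apply/ltW/archi_boundP; rewrite divr_ge0 ?ltW.
apply: le_trans h1 _; apply: le_trans (expR_ge1Dx _); by rewrite lerDr.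
Qed.

Lemma vinogradov_decoupling k (e : R) : (0 < k < p)%N -> 0 < e -> decoupling_exp p k e.
Proof.
suff H K : (K <= p)%N -> forall l, (0 < l < K)%N -> forall e : R, 0 < e -> decoupling_exp p l e.
  by move=> /andP[k0 kp] e0; apply: (H k.+1) => //; rewrite k0 ltnSn.
elim: K => [|K IH] Kp l; first by rewrite ltn0 andbF.
rewrite ltnS [(l <= _)%N]leq_eqVlt => /andP[l0 /orP[/eqP lK|lK]] e' e'0; last
  by apply: IH => //; [exact: ltnW | rewrite l0].
case: (ltnP 1 l) => l1; last first.
  have -> : l = 1%N by apply/eqP; rewrite eqn_leq l1.
  exact: decoupling_exp1.
apply: decoupling_exp_of_lower => //; first by rewrite l1 lK.
move=> ep ep0; have [|M HM] := common_scale _ ep0 (k := K); first by apply: IH; exact: ltnW.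
exists M.+1 => //; rewrite lK; apply: HM; exact: leqnSn.
Qed.
End Induction.

(** * Vinogradov's mean value *)

Section Characters.
Variable R : realType.

Lemma csqM (z z' : R[i]) : csq (z * z') = csq z * csq z'.
Proof. by case: z z' => [a b] [c d]; rewrite /csq /=; ring. Qed.

Lemma csqX (z : R[i]) n : csq (z ^+ n) = csq z ^+ n.
Proof.
elim: n => [|n IH]; last by rewrite !exprS csqM IH.
by rewrite !expr0 /csq /= expr1n expr0n /= addr0.
Qed.

Lemma complex_prim_root m : (0 < m)%N -> exists z : R[i], m.-primitive_root z.
Proof.
move=> m0; pose P : {poly R[i]} := 'X^m - 1.
have [r] := closed_field_poly_normal P.
rewrite (monicP _) ?monicXnsubC// scale1r => Dp.
have sr : size r = m.
  by apply: succn_inj; rewrite -(size_prod_XsubC r id) -Dp size_XnsubC.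
have ar : all m.-unity_root r.
  by apply/allP => z zr; rewrite /root_of_unity /= -[X in root X]/P Dp root_prod_XsubC.
have ur : uniq r.
  have nz : m%:R != 0 :> R[i] by rewrite pnatr_eq0 -lt0n.
  rewrite -separable_prod_XsubC -Dp separable_Xn_sub_1//.
have /hasP[z _ hz] := has_prim_root m0 ar ur (eq_leq (esym sr)).
by exists z.
Qed.

Section Counting.
Variables (m k N : nat) (zeta : R[i]).
Hypothesis m_gt0 : (0 < m)%N.
Hypothesis zeta_prim : m.-primitive_root zeta.

Lemma csq_zeta : csq zeta = 1.
Proof.
have h : csq zeta ^+ m = 1 by rewrite -csqX (prim_expr_order zeta_prim) /csq /= expr1n expr0n /= addr0.
by apply/eqP; rewrite -(pexpr_eq1 m_gt0 (csq_ge0 _)) h.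
Qed.

Lemma zetaXJ a : zeta ^+ a * (zeta ^+ a)^*%C = 1.
Proof. by rewrite -csqE csqX csq_zeta expr1n. Qed.

Definition moment_char (x : 'I_N) (g : {ffun 'I_k -> 'I_m}) : R[i] :=
  \prod_(j < k) (zeta ^+ (x ^ j.+1)) ^+ g j.

Lemma prod_moment_char (xs : seq 'I_N) g :
  \prod_(x <- xs) moment_char x g = \prod_(j < k) (zeta ^+ (\sum_(x <- xs) x ^ j.+1)%N) ^+ g j.
Proof.
rewrite exchange_big; apply: eq_bigr => j _; rewrite prodrXl; congr (_ ^+ _).
by elim: xs => [|x xs IH]; rewrite ?big_nil ?expr0// !big_cons exprD IH.
Qed.

Lemma sum_moment_char (xs ys : seq 'I_N) :
  \sum_g \prod_(x <- xs) moment_char x g * \prod_(y <- ys) (moment_char y g)^*%C =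
  if [forall j : 'I_k, \sum_(x <- xs) x ^ j.+1 == \sum_(y <- ys) y ^ j.+1 %[mod m]]%N
  then #|{ffun 'I_k -> 'I_m}|%:R else 0.
Proof.
pose a j := (\sum_(x <- xs) x ^ j.+1)%N; pose b j := (\sum_(y <- ys) y ^ j.+1)%N.
pose u j := zeta ^+ a j * (zeta ^+ b j)^*%C.
have uE j : (u j == 1) = (a j == b j %[mod m])%N.
  rewrite -(eq_prim_root_expr zeta_prim) /u; apply/eqP/eqP => [h|->]; last exact: zetaXJ.
  by rewrite -[RHS]mul1r -h mulrAC -mulrA zetaXJ mulr1.
have um j : u j ^+ m = 1.
  have za c : (zeta ^+ c) ^+ m = 1 by rewrite -exprM mulnC exprM (prim_expr_order zeta_prim) expr1n.
  by rewrite /u exprMn za -rmorphXn /= za rmorph1 mulr1.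
have E g : \prod_(x <- xs) moment_char x g * \prod_(y <- ys) (moment_char y g)^*%C =
    \prod_(j < k) u j ^+ g j.
  rewrite -rmorph_prod !prod_moment_char rmorph_prod -big_split; apply: eq_bigr => j _ /=.
  by rewrite rmorphXn /u exprMn.
under eq_bigr do rewrite E.
have -> : \sum_(g : {ffun 'I_k -> 'I_m}) \prod_(j < k) u j ^+ g j = \prod_(j < k) \sum_(t < m) u j ^+ t.
  by rewrite bigA_distr_bigA.
case: ifPn => [/forallP h|].
  rewrite card_ffun !card_ord natrX -[k in RHS]card_ord -prodr_const; apply: eq_bigr => j _.
  have /eqP -> : u j == 1 by rewrite uE; exact: h.
  under eq_bigr do rewrite expr1n.
  by rewrite sumr_const card_ord.
rewrite negb_forall => /existsP[j hj]; rewrite (bigD1 j)//=.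
have : (u j - 1) * \sum_(t < m) u j ^+ t = 0 by rewrite -subrX1 um subrr.
by move/eqP; rewrite mulf_eq0 subr_eq0 uE (negPf hj) /= => /eqP->; rewrite mul0r.
Qed.

End Counting.
End Characters.

Section MeanValue.
Variable R : realType.

(** Equations are relaxed to congruences mod m, which can only add solutions; these are counted by
    characters of a finite group instead of integrals. *)
Lemma count_le_moment (m k N t : nat) (zeta : R[i]) : (0 < m)%N -> m.-primitive_root zeta ->
  (#|[set uv : {ffun 'I_t -> 'I_N} * {ffun 'I_t -> 'I_N} |
     [forall j : 'I_k, \sum_i uv.1 i ^ j.+1 == \sum_i uv.2 i ^ j.+1]%N]|%:R : R) <=
  \sum_(g : {ffun 'I_k -> 'I_m}) 
    #|{ffun 'I_k -> 'I_m}|%:R^-1 * csq (\sum_(x < N) moment_char zeta x g) ^+ t.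
Proof.
move=> m0 hz; set S := [set _ | _]; set n : R := #|{ffun 'I_k -> 'I_m}|%:R.
have n0 : n != 0 by rewrite pnatr_eq0 card_ffun !card_ord expn_eq0 (gtn_eqF m0).
pose ok (u v : {ffun 'I_t -> 'I_N}) :=
  [forall j : 'I_k, \sum_(x <- codom u) x ^ j.+1 == \sum_(y <- codom v) y ^ j.+1 %[mod m]]%N.
have F (g : {ffun 'I_k -> 'I_m}) : (\sum_(x < N) moment_char zeta x g) ^+ t =
    \sum_(u : {ffun 'I_t -> 'I_N}) \prod_(x <- codom u) moment_char zeta x g.
  rewrite -[t in LHS]card_ord -prodr_const bigA_distr_bigA /=.
  by apply: eq_bigr => u _; rewrite /codom /image_mem big_map big_enum.
have -> : \sum_(g : {ffun 'I_k -> 'I_m}) n^-1 * csq (\sum_(x < N) moment_char zeta x g) ^+ t =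
    \sum_u \sum_v (ok u v)%:R :> R.
  apply: complexI; rewrite !rmorph_sum /=.
  have E (g : {ffun 'I_k -> 'I_m}) : (n^-1 * csq (\sum_(x < N) moment_char zeta x g) ^+ t)%:C%C =
      \sum_(u : {ffun 'I_t -> 'I_N}) \sum_(v : {ffun 'I_t -> 'I_N}) (n^-1)%:C%C *
        (\prod_(x <- codom u) moment_char zeta x g *
         \prod_(y <- codom v) (moment_char zeta y g)^*%C).
    rewrite rmorphM rmorphXn /= csqE exprMn -rmorphXn /= F rmorph_sum /= mulr_suml mulr_sumr.
    apply: eq_bigr => u _; rewrite !mulr_sumr; apply: eq_bigr => v _.
    by rewrite rmorph_prod.
  under eq_bigr do rewrite E.
  rewrite exchange_big; apply: eq_bigr => u _.
  rewrite exchange_big rmorph_sum; apply: eq_bigr => v _ /=.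
  rewrite -mulr_sumr (sum_moment_char _ m0 hz) -/(ok u v).
  case: (ok u v); last by rewrite mulr0 rmorph0.
  by rewrite -/n -(rmorph_nat (real_complex R)) -rmorphM mulVf.
rewrite pair_bigA /= -sum1_card natr_sum big_mkcond /=; apply: ler_sum => -[u v] _.
rewrite inE /=; case: ifP => [/forallP h|_]; last exact: ler0n.
suff -> : ok u v by [].
have C (y : {ffun 'I_t -> 'I_N}) j : (\sum_(x <- codom y) x ^ j = \sum_i y i ^ j)%N.
  by rewrite /codom /image_mem big_map big_enum.
by apply/forallP => j; rewrite !C (eqP (h j)).
Qed.

(** Pointwise, (c / B)^t is at most 1 or (c / B)^q. A critical moment bounded by D B^q thus bounds
    each lower one by B^t (D + 1). *)
Lemma moment_interpolation (T : finType) (w c : T -> R) (B : R) t q : (t <= q)%N -> 0 < B ->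
  (forall g, 0 <= w g) -> (forall g, 0 <= c g) -> \sum_g w g = 1 ->
  \sum_g w g * c g ^+ t <= B ^+ t * ((\sum_g w g * c g ^+ q) / B ^+ q + 1).
Proof.
move=> tq B0 w0 c0 w1.
rewrite -w1 mulr_suml -big_split mulr_sumr; apply: ler_sum => g _ /=.
have -> : B ^+ t * (w g * c g ^+ q / B ^+ q + w g) = w g * (B ^+ t * ((c g / B) ^+ q + 1)).
  by rewrite expr_div_n; ring.
rewrite ler_wpM2l//.
have -> : c g ^+ t = B ^+ t * (c g / B) ^+ t by rewrite -exprMn mulrC divfK// gt_eqF.
rewrite ler_wpM2l ?exprn_ge0 ?(ltW B0)//.
have x0 : 0 <= c g / B by rewrite divr_ge0// ltW.
case: (leP (c g / B) 1) => h.
  by rewrite -[leLHS]add0r lerD ?exprn_ge0// exprn_ile1.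
by rewrite -[leLHS]addr0 lerD// ler_weXn2l// ltW.
Qed.

Lemma vinogradov_count_decoupling (p k n t : nat) (X D : R) : prime p -> (t <= crit k)%N ->
  (Num.truncn X < p ^ n)%N -> decoupling p k n D ->
  (Vinogradov_count t k X)%:R <= (p ^ n)%:R ^+ t * (D + 1).
Proof.
move=> pp tq Xn dec; have p0 := prime_gt0 pp.
pose m := (p ^ (k * n))%N; have m0 : (0 < m)%N by rewrite expn_gt0 p0.
have [zeta hz] := complex_prim_root R m0.
pose N := (Num.truncn X).+1.
pose T := {ffun 'I_k -> 'I_m}; pose w (g : T) : R := #|T|%:R^-1.
have T0 : #|T|%:R != 0 :> R by rewrite pnatr_eq0 card_ffun !card_ord expn_eq0 (gtn_eqF m0).
have w1 : \sum_g w g = 1 by rewrite /w sumr_const -[LHS]mulr_natl; exact: mulfV.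
have w0 g : 0 <= w g by rewrite invr_ge0 ler0n.
pose f (x : 'I_N) (g : T) := moment_char zeta x g.
have cf x g : csq (f x g) = 1.
  apply: complexI; rewrite csqE /f /moment_char rmorph_prod -big_split /= big1// => j _.
  by rewrite rmorphXn /= -exprMn (zetaXJ m0 hz) expr1n.
(* As N <= p^n, each class mod p^n holds at most one position, so a piece is 0 or a single
   unimodular term and [lam] = 1 suffices. *)
have adm : admissible p k n w f (fun x : 'I_N => x : nat) (fun _ => 1).
  split => //.
  - move=> xs ys sxy.
    have -> : \sum_g (w g)%:C%C * (\prod_(x <- xs) f x g) * (\prod_(y <- ys) (f y g)^*%C) =
       (#|T|%:R^-1)%:C%C * \sum_g \prod_(x <- xs) f x g * \prod_(y <- ys) (f y g)^*%C.
      by rewrite mulr_sumr; apply: eq_bigr => g _; rewrite mulrA.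
    rewrite (sum_moment_char _ m0 hz); case: ifP => [/forallP h _|_]; last by rewrite mulr0 eqxx.
    move=> [_|j jk]; last by apply/eqP; exact: (h (Ordinal jk)).
    by under eq_bigr do rewrite expn0; under [in RHS]eq_bigr do rewrite expn0; rewrite !sum1_size sxy.
  - move=> z hzn; rewrite expr1n -w1; apply: ler_sum => g _.
    rewrite -[leRHS]mulr1 ler_wpM2l//; apply: exprn_ile1; first exact: csq_ge0.
    rewrite /piece; case: (ltnP z N) => zN.
      rewrite (big_pred1 (Ordinal zN)) ?cf// => x /=.
      by rewrite modn_small ?(leq_trans (ltn_ord x))// -val_eqE.
    rewrite big1 ?/csq /= ?expr0n ?addr0 ?ler01// => x /eqP xz.
    have xN := ltn_ord x; move: xz; rewrite modn_small; last exact: leq_trans xN _.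
    by move=> xz; move: xN; rewrite xz ltnNge zN.
have mom := dec T _ w f _ _ adm.
have mass1 : mass p n (fun _ => 1) 0 0 = (p ^ n)%:R :> R.
  by rewrite mass00 sumr_const card_ord.
have pieceE g : piece p f (fun x : 'I_N => x : nat) 0 0 g = \sum_x f x g.
  by rewrite /piece; apply: eq_bigl => x; rewrite expn0 modn1.
move: mom; rewrite mass1; under eq_bigr do rewrite pieceE; move=> mom.
have P0 : 0 < (p ^ n)%:R :> R by rewrite ltr0n expn_gt0 p0.
have c0 g : 0 <= csq (\sum_x f x g) by exact: csq_ge0.
apply: (@le_trans _ _ (\sum_g w g * csq (\sum_x f x g) ^+ t)); last first.
  apply: le_trans (moment_interpolation tq P0 w0 c0 w1) _.
  rewrite ler_wpM2l ?exprn_ge0 ?(ltW P0)// lerD2r ler_pdivrMr ?exprn_gt0//.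
apply: le_trans (count_le_moment k N t m0 hz).
rewrite ler_nat; apply: subset_leq_card; apply/fintype.subsetP => -[u v].
rewrite !inE /= => /andP[_ /forallP h]; apply/forallP => j.
by have /implyP := h (lift ord0 j); apply.
Qed.

Lemma vinogradov_mean_value (k t : nat) (eps : R) : (0 < k)%N -> (t <= crit k)%N -> 0 < eps ->
  exists2 C : R, 0 < C & forall X, 1 <= X -> (Vinogradov_count t k X)%:R <= C * X `^ (t%:R + eps).
Proof.
move=> k0 tq eps0.
have [p kp pp] := prime_above k; have p0 := prime_gt0 pp; have p1 := prime_gt1 pp.
have lnp : 0 < ln p%:R :> R by rewrite ln_gt0// ltr1n.
(* This rate makes exp (rate n) equal to (p^n)^eps. *)
have e0 : 0 < eps * ln p%:R by rewrite mulr_gt0.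
have [K K0 HK] := vinogradov_decoupling pp (k := k) (introT andP (conj k0 kp)) e0.
have pR : 0 < p%:R :> R by rewrite ltr0n.
exists (p%:R ^+ t * (K * p%:R `^ eps + 1)).
  by rewrite mulr_gt0 ?exprn_gt0// addr_gt0// mulr_gt0// powR_gt0.
move=> X X1; have X0 : 0 < X by exact: lt_le_trans X1.
pose N := Num.truncn X.
have NX : N%:R <= X by rewrite truncn_le// ltW.
have N0 : (0 < N)%N by rewrite truncn_gt0.
pose n := (trunc_log p N).+1.
have Nn : (N < p ^ n)%N by exact: trunc_log_ltn.
have nN : (p ^ n)%:R <= p%:R * X.
  rewrite /n expnS natrM ler_pM2l//; apply: le_trans NX; rewrite ler_nat.
  exact: trunc_logP.
apply: le_trans (vinogradov_count_decoupling pp tq Nn (HK n)) _.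
have En : expR (eps * ln p%:R * n%:R) = (p ^ n)%:R `^ eps.
  by rewrite /powR gt_eqF ?ltr0n ?expn_gt0 ?p0// natrX lnXn// -[ln _ *+ n]mulr_natr mulrA.
have pX : (p ^ n)%:R `^ eps <= p%:R `^ eps * X `^ eps.
  rewrite -powRM ?(ltW pR) ?(ltW X0)//; apply: ge0_ler_powR => //;
    rewrite ?nnegrE ?ler0n ?mulr_ge0 ?(ltW pR) ?(ltW X0) ?(ltW eps0)//.
have X1e : 1 <= X `^ eps by rewrite -(powRr0 X) ler_powR// ltW.
rewrite powRD; last by rewrite (gt_eqF X0) implybT.
rewrite powR_mulrn ?(ltW X0)//.
rewrite (_ : _ * (X ^+ t * _) = (p%:R * X) ^+ t * ((K * p%:R `^ eps + 1) * X `^ eps)); last first.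
  by rewrite exprMn; ring.
apply: ler_pM => //; rewrite ?exprn_ge0 ?ler0n//.
- by rewrite addr_ge0// mulr_ge0 ?expR_ge0// ltW.
- by rewrite lerXn2r ?nnegrE ?ler0n// mulr_ge0// ltW.
by rewrite mulrDl mul1r lerD// En -mulrA ler_wpM2l// ltW.
Qed.
End MeanValue.

(** * The range of s and r *)

Lemma Delta_ge0 (R : realType) (s r : nat) : (r <= s)%N -> 0 <= Delta R s r.
Proof.
move=> rs; rewrite /Delta big_seq_cond; apply: sumr_ge0 => m.
rewrite mem_index_iota andbT => /andP[_ mr].
rewrite divr_ge0 ?mulr_ge0 ?subr_ge0 ?ler_nat ?ler0n//.
  exact: ltnW.
by rewrite (leq_trans _ rs)// ltnW.
Qed.

(** The root lies in [0, 1], also for y > 1 where [Num.sqrt] returns 0; positivity of the product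
    then forces x > 0. *)
Lemma half_one_plus_sqrt_le (R : realType) (x y : R) : 0 <= y -> 0 < 2^-1 * x * (1 + Num.sqrt (1 - y)) ->
  2^-1 * x * (1 + Num.sqrt (1 - y)) <= x.
Proof.
move=> y0; set c := Num.sqrt _ => h.
have c0 : 0 <= c by exact: sqrtr_ge0.
have c1 : c <= 1 by rewrite -[leRHS]sqrtr1 ler_wsqrtr// gerBl.
have x0 : 0 < x.
  by move: h; rewrite pmulr_lgt0 ?pmulr_rgt0 ?invr_gt0// ltr_wpDr.
rewrite mulrAC -[leRHS]mul1r ler_pM2r//; lra.
Qed.

Lemma add_le_crit (R : realType) (s k r : nat) : (4 <= k)%N -> (2 <= r)%N ->
  r%:Z <= k%:Z - Num.ceil (2 * Num.sqrt (k%:R : R)) + 2 ->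
  2 * r%:R - 1 <= s%:R :> R -> s%:R < s1 R s k r -> (s + r <= crit k)%N.
Proof.
move=> k4 r2 hrk hs hs1.
have rs : (r <= s)%N.
  have hr : 2%:R <= r%:R :> R by rewrite ler_nat.
  by rewrite -(ler_nat R); move: hs; lra.
have D0 := Delta_ge0 R rs.
have sB : s%:R < k%:R * r%:R - 2^-1 * r%:R * (r%:R - 1) :> R.
  apply: (lt_le_trans hs1); move: (hs1); rewrite /s1; set D := Delta R s r; set A := _ + D.
  have A0 : 0 <= A.
    by rewrite addr_ge0// !mulr_ge0 ?invr_ge0// subr_ge0 ler1n (ltnW r2).
  set B := _ - _ - D => h.
  have y0 : 0 <= 4 * r%:R * A / B ^+ 2 by rewrite divr_ge0 ?sqr_ge0// !mulr_ge0.
  apply: le_trans (half_one_plus_sqrt_le y0 (le_lt_trans (ler0n _ _) h)) _.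
  by rewrite /B gerBl.
have hc : 2 * Num.sqrt k%:R <= (k%:Z - r%:Z + 2)%:~R :> R.
  apply: le_trans (ceil_ge _) _; rewrite ler_int.
  have h (c : int) : r%:Z <= k%:Z - c + 2 -> c <= k%:Z - r%:Z + 2 by lra.
  exact: (h _ hrk).
have rk : (r <= k)%N.
  have h2 : 2 <= Num.sqrt k%:R :> R.
    have -> : 2 = Num.sqrt (4%:R) :> R by rewrite -[4%:R](_ : 2 ^+ 2 = _) ?sqrtr_sqr ?ger0_norm//; lra.
    by rewrite ler_wsqrtr// ler_nat.
  have : 4%:Z%:~R <= (k%:Z - r%:Z + 2)%:~R :> R.
    by rewrite -[4%:Z%:~R]/(4%:R : R); apply: le_trans hc; move: h2; lra.
  rewrite ler_int; lia.
pose u := (k - r)%N.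
have kE : k = (r + u)%N by rewrite /u subnKC.
have hu : (4 * k <= (u + 2) ^ 2)%N.
  have E : (k%:Z - r%:Z + 2)%:~R = (u + 2)%:R :> R.
    have -> : k%:Z - r%:Z + 2 = (u + 2)%N%:Z by rewrite {1}kE; lia.
    by [].
  rewrite E in hc; rewrite -(ler_nat R) natrX natrM.
  have -> : 4%:R * k%:R = (2 * Num.sqrt k%:R) ^+ 2 :> R.
    by rewrite exprMn sqr_sqrtr ?ler0n// -natrX.
  by rewrite lerXn2r ?nnegrE ?mulr_ge0 ?sqrtr_ge0 ?ler0n.
have h2 : (2 * s + r * r < 2 * k * r + r)%N.
  rewrite -(ltr_nat R) !natrD !natrM; move: sB; lra.
(* With r = k - u the claim reduces to 2 k <= u^2 + 3 u. It follows from 4 k <= (u + 2)^2, which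
   gives u >= 2 as k >= 4. *)
rewrite -(leq_pmul2l (m := 2))// crit_mul2.
clearbody u; clear - kE hu h2 k4; subst k; nia.
Qed.
Theorem theorem9p2 (R : realType) (s k r : nat)
  (hk : (4 <= k)%N)
  (hr2 : (2 <= r)%N)
  (hrk : r%:Z <= k%:Z - Num.ceil (2 * Num.sqrt (k%:R : R)) + 2)
  (hs : Num.max (2 * r%:R - 1) (2^-1 * r%:R * (r%:R - 1) + Delta R s r)
          <= s%:R :> R)
  (hs1 : s%:R < s1 R s k r) :
  forall eps : R, 0 < eps ->
    exists2 C : R, 0 < C &
      \forall X \near +oo,
        (Vinogradov_count (s + r) k X)%:R <= C * X `^ (s%:R + r%:R + eps).
Proof.
move=> eps eps0.
have hs2 : 2 * r%:R - 1 <= s%:R :> R by apply: le_trans hs; rewrite le_max lexx.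
have k0 : (0 < k)%N by exact: leq_trans hk.
have [C C0 HC] := vinogradov_mean_value k0 (add_le_crit hk hr2 hrk hs2 hs1) eps0.
exists C => //.
near=> X.
by rewrite -natrD; apply: HC; near: X; exact: nbhs_pinfty_ge.
Unshelve. all: by end_near.
Qed.
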